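(* Given $N\in(1,\infty)$ and $K>0$, suppose that the compact measured length space $(X,d,\nu)$ has $N$-Ricci curvature bounded below by $K$. Suppose that $f$ is a Lipschitz function on $X$ with $\int_X f\,d\nu=0$. Then $$\int_X f^2\,d\nu\ \le\ \frac{N-1}{KN}\int_X|\nabla^-f|^2\,d\nu .$$
   Context: A compact measured length space $(X,d,\nu)$ is a compact length space $(X,d)$ with a Borel probability measure $\nu$. For a Lipschitz function $f$ on $X$, $|\nabla^-f|(x)=\limsup_{y\to x}\frac{[f(x)-f(y)]_+}{d(x,y)}$, $a_+=\max(a,0)$ (and $|\nabla^- f|(x)=0$ if $x$ is isolated). Transport notation: $\Gamma$ is the set of minimizing constant-speed geodesics $\gamma:[0,1]\to X$, $e_t(\gamma)=\gamma(t)$, $E=(e_0,e_1)$. A transference plan between $\mu_0,\mu_1\in P(X)$ is $\pi\in P(X\times X)$ with marginals $\mu_0,\mu_1$; it is optimal if it minimizes $\int d(x_0,x_1)^2\,d\pi$. An optimal dynamical transference plan from $\mu_0$ to $\mu_1$ is a Borel probability measure $\Pi$ on $\Gamma$ such that $\pi=E_*\Pi$ is an optimal transference plan between $\mu_0$ and $\mu_1$. Disintegrations: $d\pi(x_0,x_1)=d\pi(x_1|x_0)\,d\mu_0(x_0)=d\pi(x_0|x_1)\,d\mu_1(x_1)$. $\mathcal{DC}_N$ is the set of continuous convex $U:[0,\infty)\to\mathbb{R}$ with $U(0)=0$ such that $\lambda\mapsto\lambda^NU(\lambda^{-N})$ is convex on $(0,\infty)$. $U'(\infty)=\lim_{r\to\infty}U(r)/r$,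 $U'(0)=\lim_{r\to0^+}U(r)/r$, and $U_\nu(\mu)=\int_XU(\rho)\,d\nu+U'(\infty)\mu_s(X)$ where $\mu=\rho\nu+\mu_s$ is the Lebesgue decomposition with respect to $\nu$ ($\infty\cdot0=0$). For $K>0$, $N\in(1,\infty)$ let $\alpha=\sqrt{\frac{K}{N-1}}\,d(x_0,x_1)$ and $\beta_t(x_0,x_1)=\left(\frac{\sin(t\alpha)}{t\sin\alpha}\right)^{N-1}$ if $\alpha\in[0,\pi]$ (with limiting values where the quotient is not defined), $\beta_t(x_0,x_1)=\infty$ if $\alpha>\pi$. $(X,d,\nu)$ has $N$-Ricci curvature bounded below by $K$ if for all $\mu_0,\mu_1\in P(X)$ with support in $\mathrm{supp}(\nu)$, with Lebesgue decompositions $\mu_0=\rho_0\nu+\mu_{0,s}$, $\mu_1=\rho_1\nu+\mu_{1,s}$, there is some optimal dynamical transference plan $\Pi$ from $\mu_0$ to $\mu_1$ such that, with $\mu_t=(e_t)_*\Pi$ and $\pi=E_*\Pi$, for all $U\in\mathcal{DC}_N$ and all $t\in[0,1]$, $$U_\nu(\mu_t)\le(1-t)\int_{X\times X}\beta_{1-t}(x_0,x_1)\,U\!\left(\tfrac{\rho_0(x_0)}{\beta_{1-t}(x_0,x_1)}\right)d\pi(x_1|x_0)\,d\nu(x_0)+t\int_{X\times X}\beta_t(x_0,x_1)\,U\!\left(\tfrac{\rho_1(x_1)}{\beta_t(x_0,x_1)}\right)d\pi(x_0|x_1)\,d\nu(x_1)+U'(\infty)\big((1-t)\mu_{0,s}[X]+t\mu_{1,s}[X]\big).$$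 If $\beta_t(x_0,x_1)=\infty$, $\beta_tU(\rho_1/\beta_t)$ is interpreted as $U'(0)\rho_1(x_1)$; similarly $\beta_{1-t}U(\rho_0/\beta_{1-t})$ is interpreted as $U'(0)\rho_0(x_0)$ if $\beta_{1-t}=\infty$. *)

(* Defs.v *)
From HB Require Import structures.
From mathcomp Require Import all_boot all_order all_algebra.
From mathcomp Require Import all_classical all_reals all_analysis.
From mathcomp Require Import measurable_realfun.

Set Implicit Arguments.
Unset Strict Implicit.
Unset Printing Implicit Defensive.

Import Order.TTheory GRing.Theory Num.Theory.
Import numFieldNormedType.Exports.

Local Open Scope classical_set_scope.
Local Open Scope ring_scope.

(* measurableType is pointed, hence so must be a metric space carrying a Borel
   structure; this is harmless as a space with a probability is nonempty. *)
#[short(type="pmetricType")]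
HB.structure Definition PointedMetric (R : numDomainType) :=
  {X of Pointed X & Metric R X}.

Notation borel T := (g_sigma_algebraType (@open T)).

Lemma measurable_fun_generators (S T : pointedType) (GS : set (set S))
    (GT : set (set T)) (f : g_sigma_algebraType GS -> g_sigma_algebraType GT) :
  (forall B, GT B -> GS (f @^-1` B)) -> measurable_fun setT f.
Proof.
move=> GTS.
apply: (@measurability _ _ (g_sigma_algebraType GS) (g_sigma_algebraType GT)
  setT f GT) => //.
move=> _ [B GB <-]; rewrite setTI.
by apply: sub_sigma_algebra; exact: GTS.
Qed.

Section lebesgue_decomposition.
Context d (T : measurableType d) (R : realType).
Local Open Scope ereal_scope.

Definition is_lebesgue_decomposition (nu mu : set T -> \bar R)
    (rho : T -> R) (mus : {measure set T -> \bar R}) :=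
  [/\ measurable_fun setT rho, (forall x, (0 <= rho x)%R),
      (exists2 S, measurable S & nu S = 0 /\ mus (~` S) = 0) &
      forall A, measurable A -> mu A = \int[nu]_(x in A) (rho x)%:E + mus A].

Variables nu mu : probability T R.

Lemma ex_max_null_set : exists2 S, measurable S /\ nu S = 0 &
  forall A, measurable A -> nu A = 0 -> mu A <= mu S.
Proof.
pose E := [set mu A | A in [set A | measurable A /\ nu A = 0]].
have E0 : E !=set0 by exists (mu set0), set0; split => //; exact: measure0.
have Efin : ereal_sup E \is a fin_num.
  rewrite ge0_fin_numE; last first.
    by apply: ereal_sup_ubound; exists set0; [split => //|]; rewrite measure0.
  rewrite (@le_lt_trans _ _ 1) ?ltry//.
  by apply: ge_ereal_sup => _ [A [mA _] <-]; exact: probability_le1.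
have F n : {A | (measurable A /\ nu A = 0) /\
    ereal_sup E - (n.+1%:R^-1)%:E < mu A}.
  apply: cid.
  have e0 : (0 < n.+1%:R^-1 :> R)%R by rewrite invr_gt0.
  have [_ [A hA <-] h] := ub_ereal_sup_adherent e0 Efin.
  by exists A.
pose S := \bigcup_n sval (F n).
have mF n : measurable (sval (F n)) by case: (F n) => A [[]].
have nF n : nu (sval (F n)) = 0 by case: (F n) => A [[]].
have mS : measurable S by exact: bigcupT_measurable.
have nS : nu S = 0.
  apply: (measure_negligible mS); apply: negligible_bigcup => n.
  by apply/negligibleP; [exact: mF | exact: nF].
exists S => // A mA nA.
rewrite (@le_trans _ _ (ereal_sup E))//.
  by apply: ereal_sup_ubound; exists A.
apply/lee_addgt0Pr => e e0.
pose n := Num.truncn e^-1.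
have ne : (n.+1%:R^-1 <= e)%R.
  rewrite -(invrK e) lef_pV2 ?posrE ?invr_gt0//.
  by rewrite ltW// truncnS_gt.
rewrite -leeBlDr//; apply: (@le_trans _ _ (mu (sval (F n)))); last first.
  rewrite le_measure ?inE//.
  exact: (bigcup_sup (F := fun k => sval (F k)) (i := n)).
apply: le_trans (ltW (proj2 (svalP (F n)))).
by rewrite leeB.
Qed.

Lemma ex_lebesgue_decomposition :
  exists p : (T -> R) * {measure set T -> \bar R},
    is_lebesgue_decomposition nu mu p.1 p.2.
Proof.
have [S [mS nS] Smax] := ex_max_null_set.
have mCS : measurable (~` S) by exact: measurableC.
have moo : mu (~` S) < +oo by rewrite -ge0_fin_numE// fin_num_measure.
pose ac : {finite_measure set T -> \bar R} := mfrestr mCS moo.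
have acnu : ac `<< nu.
  apply/null_content_dominatesP => A mA nA.
  change (mu (A `&` ~` S) = 0).
  have mAS : measurable (A `&` ~` S) by exact: measurableI.
  have nAS : nu (S `|` (A `&` ~` S)) = 0.
    apply: null_set_setU => //.
    by apply: (subset_measure0 mAS mA) => //; exact: subIsetl.
  have := Smax _ (measurableU _ _ mS mAS) nAS.
  rewrite measureU//; last by rewrite setICA setICr setI0.
  rewrite -[leRHS]adde0 leeD2lE ?fin_num_measure// => h.
  by apply/eqP; rewrite eq_le h measure_ge0.
have [f [f0 ffin fint fE]] := radon_nikodym_sigma_finite acnu.
pose mus : {measure set T -> \bar R} := mrestr mu mS.
exists (fine \o f, mus); split => /=.
- exact: (measurableT_comp (fine_measurable measurableT) (measurable_int nu fint)).
- by move=> x; rewrite fine_ge0.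
- by exists S => //; split => //=; rewrite /mus /mrestr setICl measure0.
- move=> A mA; rewrite (eq_integral f); last by move=> x _ /=; rewrite fineK.
  by rewrite -fE//= /mus /mfrestr /mrestr -setDE -measureDI.
Qed.

Definition density : T -> R := (sval (cid ex_lebesgue_decomposition)).1.

Definition singular_part : {measure set T -> \bar R} :=
  (sval (cid ex_lebesgue_decomposition)).2.

Lemma lebesgue_decompositionP :
  is_lebesgue_decomposition nu mu density singular_part.
Proof. exact: (svalP (cid ex_lebesgue_decomposition)). Qed.

End lebesgue_decomposition.

Section length_space.
Context (R : realType) (X : metricType R).

Definition curve_length (c : R -> X) : \bar R :=
  ereal_sup [set (let F := c \o nth 1 (0 :: s) in
                  \sum_(0 <= i < size s) mdist (F i) (F i.+1))%:E
            | s in itv_partition 0 1].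

Definition length_space := forall x y : X,
  (mdist x y)%:E =
  ereal_inf [set curve_length c | c in
    [set c : R -> X | [/\ {within `[0, 1], continuous c}, c 0 = x & c 1 = y]]].

Definition lipschitz_fun (f : X -> R) :=
  exists L : R, forall x y, `|f x - f y| <= L * mdist x y.

(* at an isolated point limf_esup would be -oo, hence the case distinction *)
Definition descending_slope (f : X -> R) (x : X) : \bar R :=
  if `[< isolated [set: X] x >] then 0%E
  else limf_esup (fun y => (Num.max (f x - f y) 0 / mdist x y)%:E) x^'.

End length_space.

Section geodesics.
Context (R : realType) (X : pmetricType R).

Definition minimizing_geodesic : set {uniform {i01 R} -> X} :=
  [set c | forall s t : {i01 R},
    mdist (c s) (c t) = `|s%:num - t%:num| * mdist (c 0%:i01) (c 1%:i01)].

(* its Borel sets are those of the topology of uniform convergence *)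
Definition geodesic : Type := set_type minimizing_geodesic.

Lemma cst_geodesic : (fun=> point) \in minimizing_geodesic.
Proof. by rewrite inE => s t; rewrite !mdistxx mulr0. Qed.

HB.instance Definition _ :=
  Topological.copy geodesic (set_type minimizing_geodesic).
HB.instance Definition _ :=
  isPointed.Build geodesic (exist _ (fun=> point) cst_geodesic).

Definition eval_geodesic (t : {i01 R}) (c : borel geodesic) : borel X :=
  set_val c t.

Definition endpoints (c : borel geodesic) : borel (X * X)%type :=
  (eval_geodesic 0%:i01 c, eval_geodesic 1%:i01 c).

Lemma continuous_eval_geodesic (t : {i01 R}) :
  continuous (eval_geodesic t : geodesic -> X).
Proof.
move=> c A; rewrite -nbhs_entourageE => -[E entE EA].
have cc : continuous (set_val : geodesic -> {uniform {i01 R} -> X}).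
  exact: initial_continuous.
apply: (cc c [set h | A (h t)]).
apply/uniform_nbhs; exists E; split => // h Eh.
by apply: EA; apply/xsectionP; exact: Eh.
Qed.

Lemma measurable_eval_geodesic t : measurable_fun setT (eval_geodesic t).
Proof.
by apply: measurable_fun_generators; apply/continuousP/continuous_eval_geodesic.
Qed.

Lemma measurable_endpoints : measurable_fun setT endpoints.
Proof.
have ce : continuous (endpoints : geodesic -> (X * X)%type).
  move=> c; apply: cvg_pair.
  - exact: nbhs_filter.
  - exact: continuous_eval_geodesic.
  - exact: continuous_eval_geodesic.
by apply: measurable_fun_generators; apply/continuousP.
Qed.

HB.instance Definition _ t := isMeasurableFun.Build _ _ _ _
  (eval_geodesic t) (measurable_eval_geodesic t).

HB.instance Definition _ := isMeasurableFun.Build _ _ _ _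
  endpoints measurable_endpoints.

End geodesics.

Section transport.
Context (R : realType) (X : pmetricType R).
Implicit Types (mu : probability (borel X) R)
  (pi : probability (borel (X * X)%type) R)
  (Pi : probability (borel (geodesic X)) R)
  (k : R.-pker (borel X) ~> (borel X)).
Local Open Scope ereal_scope.

Definition transference_plan mu0 mu1 pi :=
  forall A : set (borel X), measurable A ->
    pi (A `*` [set: X]) = mu0 A /\ pi ([set: X] `*` A) = mu1 A.

Definition transport_cost pi := \int[pi]_z (mdist z.1 z.2 ^+ 2)%:E.

Definition optimal_plan mu0 mu1 pi :=
  transference_plan mu0 mu1 pi /\
  forall pi', transference_plan mu0 mu1 pi' ->
    transport_cost pi <= transport_cost pi'.

Definition optimal_dynamical_plan mu0 mu1 Pi :=
  optimal_plan mu0 mu1 (distribution Pi (@endpoints R X)).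

Definition disintegration_fst mu0 pi k :=
  forall C : set (borel (X * X)%type), measurable C ->
  pi C = \int[mu0]_x0 k x0 (xsection C x0).

Definition disintegration_snd mu1 pi k :=
  forall C : set (borel (X * X)%type), measurable C ->
  pi C = \int[mu1]_x1 k x1 (ysection C x1).

End transport.

Section functional.
Context (R : realType).
Implicit Types (U : R -> R) (N K : R).

(* U stands for its restriction to [0, +oo[ *)
Definition DC N U :=
  [/\ {within `[0, +oo[, continuous U},
      convex_function (`[0, +oo[%classic : set R) U,
      U 0 = 0 &
      convex_function (`]0, +oo[%classic : set R)
        (fun l : R => l `^ N * U (l `^ (- N)))].

Definition dinfty U : \bar R := lim ((U r / r)%:E @[r --> +oo%R]).

Definition dzero U : \bar R := lim ((U r / r)%:E @[r --> 0^'+]).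

Definition U_functional d (T : measurableType d) U (nu mu : probability T R) :=
  (\int[nu]_x (U (density nu mu x))%:E
   + dinfty U * singular_part nu mu setT)%E.

(* (sin (t a) / (t sin a)) ^ (N - 1), the undefined quotients being limits:
   a -> 0 gives 1 (also at t = 0), t -> 0 gives a / sin a, and a -> pi
   gives 1 if t = 1 and +oo if t < 1 *)
Definition beta K N (t : R) (X : metricType R) (x0 x1 : X) : \bar R :=
  let a := Num.sqrt (K / (N - 1)) * mdist x0 x1 in
  if pi < a then +oo%E
  else if a == 0 then 1%E
  else if a == pi then (if t == 1 then 1%E else +oo%E)
  else if t == 0 then ((a / sin a) `^ (N - 1))%:E
  else ((sin (t * a) / (t * sin a)) `^ (N - 1))%:E.

(* b U(r / b), read as U'(0) r when b = +oo *)
Definition scaled U (b : \bar R) (r : R) : \bar R :=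
  if b is b'%:E then (b' * U (r / b'))%:E else (dzero U * r%:E)%E.

End functional.

Section ricci.
Context (R : realType) (X : pmetricType R).
Local Open Scope ereal_scope.

Definition supp (mu : probability (borel X) R) : set X :=
  [set x | forall A, open_nbhs x A -> 0 < mu A].

(* The right-hand side does not depend on the choice of the disintegrations:
   k0 is unique mu0-almost everywhere and the integrand vanishes where rho0
   does, and similarly for k1. *)
Definition ricci_bounded_below (N K : R) (nu : probability (borel X) R) :=
  forall mu0 mu1 : probability (borel X) R,
  supp mu0 `<=` supp nu -> supp mu1 `<=` supp nu ->
  exists Pi : probability (borel (geodesic X)) R,
  optimal_dynamical_plan mu0 mu1 Pi /\
  exists k0 k1 : R.-pker (borel X) ~> (borel X),
  let plan := distribution Pi (@endpoints R X) in
  let rho0 := density nu mu0 in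
  let rho1 := density nu mu1 in
  [/\ disintegration_fst mu0 plan k0,
      disintegration_snd mu1 plan k1 &
      forall U, DC N U -> forall t : {i01 R},
      let s := t%:num in
      U_functional U nu (distribution Pi (@eval_geodesic R X t)) <=
        (1 - s)%:E *
          \int[nu]_x0 \int[k0 x0]_x1
            scaled U (beta K N (1 - s) (x0 : X) (x1 : X)) (rho0 x0)
        + s%:E *
          \int[nu]_x1 \int[k1 x1]_x0
            scaled U (beta K N s (x0 : X) (x1 : X)) (rho1 x1)
        + dinfty U * ((1 - s)%:E * singular_part nu mu0 setT
                      + s%:E * singular_part nu mu1 setT)].

End ricci.

(* Main.v *)
From HB Require Import structures.
Require Import Defs.
From mathcomp Require Import all_boot all_order all_algebra.
From mathcomp Require Import all_classical all_reals all_analysis.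
From mathcomp Require Import measurable_realfun.
From mathcomp Require Import ring lra.

(** The inequality is the second-order expansion, around [nu], of the
    displacement convexity of one entropy.

    Put [p = 1 - 1/N] and [U r = - r^p], for which [r |-> r^N U (r^-N)] is
    linear. Move the perturbation [mu = sigma nu], [sigma = 1 + eps f], to [nu]
    along the plan [Pi] given by the curvature bound, and let [D] be its
    quadratic cost. As [log (sin x / x) + x^2 / 6] decreases on [0, pi[,
      [beta_t >= exp (K (1 - t^2) d^2 / 6)],
    hence [beta_t^(1/N) >= 1 + K (1 - t^2) d^2 / (6 N)], and the right-hand side
    of the curvature condition only involves [I], the integral of [sigma^p], and
    [D]. On the left-hand side the concavity of [r^p] replaces the density of
    [mu_t] by its tangent at [sigma], leaving the integral of
    [sigma (gamma_t)^(p-1)], a continuous function, along the geodesics. The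
    powers of [sigma] being close to [1], dividing by [t] and letting [t] tend
    to [0] gives, up to factors tending to [1],
      [1 - I + K D / (2 N) <=
         p (eps / N) * integral of |grad^- f|(gamma_0) d(gamma_0, gamma_1)].
    Young's inequality splits the integrand on the right into a multiple of
    [|grad^- f|^2] and a multiple of [d^2]; the weights are chosen so that the
    latter is exactly the [D]-term on the left. Since
      [1 - I >= p (1 - p) / 2 * eps^2 * integral of f^2]
    up to the same factors, dividing by [eps^2] yields the constant
    [p / K = (N - 1) / (K N)].

    No derivative in [t] is taken: [|grad^- f|] is first replaced by the supremum
    of its difference quotients at scale [1 / (n + 1)] (local_slope), which
    controls [f (gamma_0) - f (gamma_t)] as soon as [t] is small enough. A single
    [t] and a single [eps] then give the estimate with an error factor
    [(1 - 3 eta)^6] (spectral_gap_local_slope). It remains to let [eta] tend to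
    [0], and then [n] to infinity by dominated convergence. *)

Set Implicit Arguments.
Unset Strict Implicit.
Unset Printing Implicit Defensive.

Import Order.TTheory GRing.Theory Num.Theory.
Import numFieldNormedType.Exports.

Local Open Scope classical_set_scope.
Local Open Scope ring_scope.

(** * A Gaussian lower bound for the cardinal sine *)

Section sine.
Context {R : realType}.
Implicit Types x y : R.

Lemma mul_cos_le_sin x : 0 <= x <= pi -> x * cos x <= sin x.
Proof.
move=> /andP[x0 xpi].
pose h := fun z : R => sin z - z * cos z.
have dh (z : R) : is_derive z (1 : R) h (z * sin z).
  by apply: is_derive_eq; rewrite /GRing.scale/=; ring.
have := @ger0_derive1_ndecr R h 0 pi _ _ _ 0 x (lexx _) x0 xpi.
rewrite /h sin0 mul0r subrr subr_ge0; apply.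
- by move=> z _; exact: ex_derive.
- move=> z; rewrite in_itv/= => /andP[z0 zpi].
  by rewrite derive1E derive_val mulr_ge0 ?(ltW z0)// sin_ge0_pi// ?(ltW z0) ?(ltW zpi).
- apply: derivable_within_continuous => z _; exact: ex_derive.
Qed.

(** The derivative of the difference of the two sides is
    [z / 3 * (sin z - z cos z)]. *)
Lemma mul_cos_le_sin_sqr x : 0 <= x <= pi ->
  x * cos x <= sin x * (1 - x ^+ 2 / 3).
Proof.
move=> /andP[x0 xpi].
pose h := fun z : R => sin z * (1 - z ^+ 2 / 3) - z * cos z.
have dh (z : R) : is_derive z (1 : R) h (z / 3 * (sin z - z * cos z)).
  by apply: is_derive_eq; rewrite /GRing.scale/=; field.
have := @ger0_derive1_ndecr R h 0 pi _ _ _ 0 x (lexx _) x0 xpi.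
rewrite /h sin0 !mul0r subrr subr_ge0; apply.
- by move=> z _; exact: ex_derive.
- move=> z; rewrite in_itv/= => /andP[z0 zpi].
  rewrite derive1E derive_val mulr_ge0 ?divr_ge0 ?(ltW z0)//.
  by rewrite subr_ge0 mul_cos_le_sin// !ltW.
- apply: derivable_within_continuous => z _; exact: ex_derive.
Qed.

(** The function [exp (z^2 / 6) * sin z / z] is nonincreasing: the sign of its
    derivative is that of [z cos z - sin z (1 - z^2 / 3)]. The constant [1/6] is
    the Taylor coefficient of [- log (sin z / z)] at [0], so that nothing is
    lost to second order. *)
Lemma sinc_gaussian_le x y : 0 < x -> x <= y -> y < pi ->
  expR ((y ^+ 2 - x ^+ 2) / 6) * (sin y / y) <= sin x / x.
Proof.
move=> x0 xy ypi.
pose h := fun z : R => expR (z ^+ 2 / 6) * (sin z / z).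
have dh (z : R) : 0 < z -> is_derive z (1 : R) h
    (expR (z ^+ 2 / 6) / z ^+ 2 *
      (z * cos z - sin z * (1 - z ^+ 2 / 3))).
  move=> z0; have zneq : z != 0 by rewrite gt_eqF.
  have dV : is_derive z (1 : R) (fun u : R => u^-1) (- z ^- 2 *: (1 : R)).
    exact: (@is_deriveV _ id z 1 1).
  have dS : is_derive z (1 : R) (fun u : R => u ^+ 2 / 6) (z / 3).
    by apply: is_derive_eq; rewrite /GRing.scale/=; field.
  have dE : is_derive z (1 : R) (fun u : R => expR (u ^+ 2 / 6))
      (expR (z ^+ 2 / 6) * (z / 3)).
    exact: (@is_derive1_comp _ expR (fun u : R => u ^+ 2 / 6)).
  rewrite /h; apply: is_derive_eq; rewrite /GRing.scale/=; field.
  done.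
have hxy : h y <= h x.
  apply: (@ler0_derive1_nincr R h x y _ _ _ x y (lexx x) xy (lexx y)).
  - move=> z; rewrite in_itv/= => /andP[xz _].
    by have ? := dh z (lt_trans x0 xz); exact: ex_derive.
  - move=> z; rewrite in_itv/= => /andP[xz zy].
    have z0 := lt_trans x0 xz.
    have ? := dh z z0; rewrite derive1E derive_val.
    rewrite mulr_ge0_le0 ?divr_ge0 ?expR_ge0 ?exprn_ge0 ?(ltW z0)//.
    by rewrite subr_le0 mul_cos_le_sin_sqr// (ltW z0) ltW// (lt_trans zy).
  - apply: derivable_within_continuous => z; rewrite in_itv/= => /andP[xz _].
    by have ? := dh z (lt_le_trans x0 xz); exact: ex_derive.
rewrite mulrBl expRB mulrAC -(ler_pM2l (expR_gt0 (x ^+ 2 / 6))).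
rewrite -[X in _ <= X]/(h x); apply: le_trans hxy; rewrite /h.
by rewrite mulrC mulrA divfK// gt_eqF// expR_gt0.
Qed.

End sine.

(** * Powers near 1 *)

Section powers.
Context {R : realType}.
Implicit Types (x y a p q eta u : R).

(** The graph of the concave function [x |-> x^p] lies below its tangent at [y];
    by homogeneity this is the concavity of [ln] between [x / y] and [1]. *)
Lemma powR_tangent p x y : 0 < p < 1 -> 0 <= x -> 0 < y ->
  x `^ p <= (1 - p) * y `^ p + p * (y `^ (p - 1) * x).
Proof.
move=> /andP[p0 p1] x0 y0; have pge0 := ltW p0.
have [->|xn0] := eqVneq x 0.
  rewrite powR0 ?gt_eqF// !mulr0 addr0 mulr_ge0 ?powR_ge0//; lra.
have {}x0 : 0 < x by rewrite lt_neqAle eq_sym xn0.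
pose r := x / y; have r0 : 0 < r by rewrite divr_gt0.
have bern : r `^ p <= p * r + (1 - p).
  have p01 : 0 <= p <= 1 by rewrite pge0 ltW.
  have := @concave_ln R (Itv01 pge0 (ltW p1)) r 1 r0 ltr01.
  rewrite !convRE/= ln1 mulr0 addr0 mulr1 => h.
  have z0 : 0 < p * r + (1 - p) by have := mulr_gt0 p0 r0; lra.
  by rewrite /powR gt_eqF// -[leRHS](lnK (x := _))// ler_expR.
have yp : 0 <= y `^ p by exact: powR_ge0.
have := ler_wpM2l yp bern.
rewrite -powRM// ?(ltW y0) ?(ltW r0)// /r mulrC divfK ?gt_eqF// => /le_trans; apply.
rewrite powRB; last by rewrite [y == 0]gt_eqF// implybT.
rewrite powRr1 ?(ltW y0)//.
by rewrite le_eqVlt; apply/orP; left; apply/eqP; ring.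
Qed.

(** For exponents in [[-2, 0]] it is enough to compare with [y^-2] and [y^0]. The
    bound [1 - 3 eta] is a polynomial minorant of both [(1 - eta)^2] and
    [(1 + eta)^-2]. *)
Lemma powR_near1 eta a y : 0 < eta < 3^-1 -> - 2 <= a <= 0 ->
  1 - eta <= y <= 1 + eta ->
  1 - 3 * eta <= y `^ a <= (1 - 3 * eta)^-1.
Proof.
move=> /andP[e0 e1] /andP[a2 a0] /andP[y0 y1].
have q0 : 0 < 1 - 3 * eta by lra.
have y_gt0 : 0 < y by lra.
have hm2 z : 0 < z -> z `^ (-2) = z ^- 2.
  by move=> z0; rewrite (powR_invn 2)// ltW.
have [y_lt1|y_ge1] := leP y 1.
- have yi : 0 < y <= 1 by rewrite y_gt0.
  have h1 : 1 <= y `^ a by rewrite -(powRr0 y); exact: ger_powR.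
  have h2 : y `^ a <= y `^ (-2) by exact: ger_powR.
  apply/andP; split; first by rewrite (le_trans _ h1)//; lra.
  rewrite (le_trans h2)// hm2// lef_pV2 ?posrE// ?exprn_gt0//.
  by nra.
- have yi : 1 <= y by rewrite ltW.
  have h1 : y `^ a <= 1 by rewrite -(powRr0 y); exact: ler_powR.
  have h2 : y `^ (-2) <= y `^ a by exact: ler_powR.
  apply/andP; split; last by rewrite (le_trans h1)// invf_ge1//; lra.
  rewrite (le_trans _ h2)// hm2// -[leLHS]invrK lef_pV2 ?posrE ?invr_gt0 ?exprn_gt0//.
  rewrite -[leRHS]mul1r ler_pdivlMr//.
  have : y ^+ 2 <= (1 + eta) ^+ 2 by rewrite ler_sqr ?nnegrE//; lra.
  have : (1 + eta) ^+ 2 * (1 - 3 * eta) <= 1 by nra.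
  by nra.
Qed.

(** By the mean value theorem, the derivative [a z^(a-1)] having an exponent in
    the range of the previous lemma. *)
Lemma powR_slope_near1 eta a x y : 0 < eta < 3^-1 -> - 1 <= a <= 0 ->
  1 - eta <= x <= 1 + eta -> 1 - eta <= y <= 1 + eta ->
  y `^ a - x `^ a <= - a / (1 - 3 * eta) * Num.max (x - y) 0.
Proof.
move=> eta01 /andP[a1 a0] xi yi; move: (eta01) => /andP[e0 e1].
have x_gt0 : 0 < x by lra.
have y_gt0 : 0 < y by lra.
have q0 : 0 < 1 - 3 * eta by lra.
have [yx|xy] := ltP y x; last first.
  rewrite max_r ?subr_le0// mulr0 subr_le0.
  rewrite -[a]opprK [x `^ _]powRN [y `^ _]powRN lef_pV2 ?posrE ?powR_gt0//.
  by rewrite ge0_ler_powR ?nnegrE ?oppr_ge0// ltW.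
rewrite max_l; last by rewrite subr_ge0 ltW.
have dpow (u : R) : u \in `]y, x[ ->
    is_derive u (1 : R) (fun v : R => v `^ a) (a * u `^ (a - 1)).
  rewrite in_itv/= => /andP[yu _]; apply: is_derive1_powR.
  exact: lt_trans yu.
have cpow : {within `[y, x], continuous (fun v : R => v `^ a)}.
  apply: derivable_within_continuous => z; rewrite in_itv/= => /andP[yz _].
  have ? := is_derive1_powR a (lt_le_trans y_gt0 yz).
  exact: ex_derive.
have [z] := MVT yx dpow cpow.
rewrite in_itv/= => /andP[yz zx] E.
rewrite -opprB E -[leLHS]mulNr -[X in X * _ <= _]mulNr ler_wpM2r ?subr_ge0 ?(ltW yx)//.
rewrite ler_wpM2l ?oppr_ge0//.
have za : -2 <= a - 1 <= 0 by lra.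
have zi : 1 - eta <= z <= 1 + eta by lra.
by have /andP[] := powR_near1 eta01 za zi.
Qed.

(** The difference of the two sides vanishes to first order at [1], and its
    second derivative is [p (1 - p) (u^(p-2) - (1 - 3 eta)) >= 0]. *)
Lemma powR_le_quadratic eta p y : 0 < eta < 3^-1 -> 0 < p < 1 ->
  1 - eta <= y <= 1 + eta ->
  y `^ p + (1 - 3 * eta) * (p * (1 - p) / 2) * (y - 1) ^+ 2 <= 1 + p * (y - 1).
Proof.
move=> eta01 /andP[p0 p1] yi; move: (eta01) => /andP[e0 e1].
set q := 1 - 3 * eta.
have q0 : 0 < q by rewrite /q; lra.
pose h u : R := 1 + p * (u - 1) - q * (p * (1 - p) / 2) * (u - 1) ^+ 2 - u `^ p.
pose h' u : R := p * (1 - u `^ (p - 1)) - q * (p * (1 - p)) * (u - 1).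
pose h'' u : R := p * (1 - p) * (u `^ (p - 2) - q).
have dh (u : R) : 0 < u -> is_derive u (1 : R) h (h' u).
  move=> u0; have ? := is_derive1_powR p u0.
  by apply: is_derive_eq; rewrite /GRing.scale/= /h'; field.
have dh' (u : R) : 0 < u -> is_derive u (1 : R) h' (h'' u).
  move=> u0; have ? := is_derive1_powR (p - 1) u0.
  apply: is_derive_eq; rewrite /GRing.scale/= /h''.
  by rewrite (_ : p - 1 - 1 = p - 2); [ring|ring].
have h''0 u : 1 - eta <= u <= 1 + eta -> 0 <= h'' u.
  move=> ui; have pa : -2 <= p - 2 <= 0 by lra.
  have /andP[h1 _] := powR_near1 eta01 pa ui.
  by rewrite /h'' mulr_ge0 ?subr_ge0// mulr_ge0// ?subr_ge0 ltW.
have nd_h' u v : 1 - eta <= u -> u <= v -> v <= 1 + eta -> h' u <= h' v.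
  apply: (@ger0_derive1_ndecr R h' (1 - eta) (1 + eta)).
  - move=> z; rewrite in_itv/= => zi.
    by have ? := dh' z ltac:(lra); exact: ex_derive.
  - move=> z; rewrite in_itv/= => zi.
    by have ? := dh' z ltac:(lra); rewrite derive1E derive_val h''0//; lra.
  - apply: derivable_within_continuous => z; rewrite in_itv/= => zi.
    by have ? := dh' z ltac:(lra); exact: ex_derive.
have h'1 : h' 1 = 0 by rewrite /h' powR1 !subrr !mulr0 subrr.
have h1 : h 1 = 0 by rewrite /h powR1 !subrr expr0n/= !mulr0 addr0 subr0 subrr.
suff : 0 <= h y by rewrite /h; lra.
have [y1|y1] := leP y 1.
- have nih u v : 1 - eta <= u -> u <= v -> v <= 1 -> h v <= h u.
    apply: (@ler0_derive1_nincr R h (1 - eta) 1).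
    + move=> z; rewrite in_itv/= => zi.
      by have ? := dh z ltac:(lra); exact: ex_derive.
    + move=> z; rewrite in_itv/= => zi.
      have ? := dh z ltac:(lra); rewrite derive1E derive_val -h'1.
      by apply: nd_h'; lra.
    + apply: derivable_within_continuous => z; rewrite in_itv/= => zi.
      by have ? := dh z ltac:(lra); exact: ex_derive.
  by rewrite -h1; apply: nih; lra.
- have ndh u v : 1 <= u -> u <= v -> v <= 1 + eta -> h u <= h v.
    apply: (@ger0_derive1_ndecr R h 1 (1 + eta)).
    + move=> z; rewrite in_itv/= => zi.
      by have ? := dh z ltac:(lra); exact: ex_derive.
    + move=> z; rewrite in_itv/= => zi.
      have ? := dh z ltac:(lra); rewrite derive1E derive_val -h'1.
      by apply: nd_h'; lra.
    + apply: derivable_within_continuous => z; rewrite in_itv/= => zi.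
      by have ? := dh z ltac:(lra); exact: ex_derive.
  by rewrite -h1; apply: ndh; lra.
Qed.

End powers.

(** * The power functional and the distortion coefficients *)

Section power_functional.
Context {R : realType}.
Implicit Types (N K p q : R).

(** Convexity is the tangent inequality at the barycenter, averaged; the last
    condition holds because [l^N * (l^-N)^p = l]. *)
Lemma power_in_DC N : 1 < N -> DC N (fun r => - r `^ (1 - N^-1)).
Proof.
move=> N1; have N0 : 0 < N by lra.
have Ni0 : 0 < N^-1 by rewrite invr_gt0.
have Ni1 : N^-1 < 1 by rewrite invf_lt1.
set p := 1 - N^-1.
have p01 : 0 < p < 1 by rewrite /p; lra.
have p0 : 0 < p by lra.
split.
(* the power is not differentiable at the origin, where [y < e^(1/p)] gives
   [y^p < e] *)
- apply/subspace_continuousP => x /=; rewrite in_itv/= andbT => x0.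
  apply: cvgN; move: x0; rewrite le_eqVlt => /predU1P[<-|x0].
    rewrite powR0 ?gt_eqF//.
    apply/cvgrPdist_lt => e e0.
    have ep : 0 < e `^ p^-1 by exact: powR_gt0.
    near=> y.
    have y0 : 0 <= y.
      have : `[0, +oo[%classic y by near: y; exact: withinT.
      by rewrite /= in_itv/= andbT.
    rewrite sub0r normrN ger0_norm ?powR_ge0//.
    rewrite (@lt_le_trans _ _ ((e `^ p^-1) `^ p))//.
      apply: gt0_ltr_powR => //; rewrite ?nnegrE ?powR_ge0//.
      near: y; apply: cvg_within.
      exact: (@lt_nbhsl R 0 (e `^ p^-1)).
    by rewrite -powRrM mulVf ?gt_eqF// powRr1// ltW.
  apply: cvg_within_filter.
  have ? := is_derive1_powR p x0.
  have : {for x, continuous (fun r : R => r `^ p)}.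
    by apply/differentiable_continuous/derivable1_diffP; exact: ex_derive.
  exact.
- move=> t x y; rewrite !inE/= !in_itv/= !andbT => x0 y0.
  pose z : R := t%:num * x + (1 - t%:num) * y.
  change (- z `^ p <= t%:num * - (x : R) `^ p + (1 - t%:num) * - (y : R) `^ p).
  have t0 : 0 <= t%:num :> R by [].
  have t1 : 0 <= 1 - t%:num :> R by rewrite subr_ge0.
  have : 0 <= z by rewrite addr_ge0// mulr_ge0.
  rewrite !mulrN -opprD.
  rewrite lerN2 le_eqVlt => /predU1P[/esym z0|z0].
    have : t%:num * x = 0 /\ (1 - t%:num) * y = 0.
      have zE : t%:num * x + (1 - t%:num) * y = 0 by exact: z0.
      have := mulr_ge0 t0 x0; have := mulr_ge0 t1 y0.
      by move=> ? ?; split; lra.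
    rewrite z0 powR0 ?gt_eqF//.
    move=> [/eqP + /eqP]; rewrite !mulf_eq0.
    move=> /orP[|] /eqP-> /orP[|] /eqP->;
      by rewrite ?powR0 ?gt_eqF// ?mul0r ?mulr0 ?addr0.
  have hx := ler_wpM2l t0 (powR_tangent p01 x0 z0).
  have hy := ler_wpM2l t1 (powR_tangent p01 y0 z0).
  have zz : z `^ (p - 1) * z = z `^ p by rewrite mulrC mulr_powRB1// ltW.
  rewrite (le_trans (lerD hx hy))// -[in leRHS]zz.
  by rewrite le_eqVlt; apply/orP; left; apply/eqP; rewrite -zz /z; ring.
- by rewrite powR0 ?oppr0// gt_eqF.
- move=> t x y; rewrite !inE/= !in_itv/= !andbT => x0 y0.
  have lin l : 0 < l -> l `^ N * - (l `^ - N) `^ p = - l.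
    move=> l0; rewrite -powRrM mulrN -powRD; last by rewrite [l == 0]gt_eqF// implybT.
    rewrite /p (_ : N + - N * (1 - N^-1) = 1); last by field; rewrite gt_eqF.
    by rewrite powRr1// ltW.
  pose z : R := t%:num * x + (1 - t%:num) * y.
  have z0 : 0 < z.
    have : 0 <= t%:num :> R by [].
    have : t%:num <= 1 :> R by [].
    rewrite /z; move: (t%:num) => s s1; rewrite le_eqVlt => /predU1P[<-|s0].
      by rewrite mul0r add0r subr0 mul1r.
    by rewrite ltr_pwDl// ?mulr_gt0// mulr_ge0// ?subr_ge0// ltW.
  change (z `^ N * - (z `^ - N) `^ p <=
    t%:num * ((x : R) `^ N * - ((x : R) `^ - N) `^ p) +
    (1 - t%:num) * ((y : R) `^ N * - ((y : R) `^ - N) `^ p)).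
  by rewrite !lin// /z !mulrN -opprD.
Unshelve. all: by end_near. Qed.

Lemma cvg_powR_pinfty p : 0 < p -> r `^ (- p) @[r --> +oo] --> 0.
Proof.
move=> p0; apply/cvgrPdist_lt => e e0; near=> r.
have r0 : 0 < r by near: r; exact: nbhs_pinfty_gt.
have er : e `^ (- p^-1) < r by near: r; exact: nbhs_pinfty_gt.
rewrite sub0r normrN ger0_norm ?powR_ge0//.
rewrite powRN -[ltRHS]invrK ltf_pV2 ?posrE ?invr_gt0 ?powR_gt0//.
have := gt0_ltr_powR p0 _ _ er; rewrite !nnegrE powR_ge0 ltW// => /(_ isT isT).
by rewrite -powRrM mulNr mulVf ?gt_eqF// powR_inv1// ltW.
Unshelve. all: by end_near. Qed.

Lemma dinfty_power N : 1 < N -> dinfty (fun r : R => - r `^ (1 - N^-1)) = 0%E.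
Proof.
move=> N1; have N0 : 0 < N by lra.
have Ni0 : 0 < N^-1 by rewrite invr_gt0.
apply: cvg_lim => //.
apply: (@cvg_trans _ ((- (r `^ (- N^-1)))%:E @[r --> +oo])).
  apply: near_eq_cvg; near=> r.
  have r0 : 0 < r by near: r; exact: nbhs_pinfty_gt.
  rewrite mulNr addrC powRD; last by rewrite [r == 0]gt_eqF// implybT.
  by rewrite powRr1 ?(ltW r0)// mulfK ?gt_eqF.
apply: cvg_EFin; first by near=> r.
rewrite -[X in _ --> X]oppr0; apply: cvgN.
exact: cvg_powR_pinfty.
Unshelve. all: by end_near. Qed.

Lemma dzero_power N : 1 < N -> dzero (fun r : R => - r `^ (1 - N^-1)) = -oo%E.
Proof.
move=> N1; have N0 : 0 < N by lra.
apply: cvg_lim => //.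
apply/cvgeNyPle => M; near=> r.
have r0 : 0 < r by near: r; exact: nbhs_right_gt.
rewrite lee_fin mulNr.
have -> : r `^ (1 - N^-1) / r = r `^ (- N^-1).
  rewrite addrC powRD; last by rewrite [r == 0]gt_eqF// implybT.
  by rewrite powRr1 ?(ltW r0)// mulfK ?gt_eqF.
rewrite lerNl.
have M0 : 0 < `|M| + 1 by rewrite ltr_wpDl.
have rM : r < (`|M| + 1) `^ (- N) by near: r; apply: nbhs_right_lt; exact: powR_gt0.
rewrite (@le_trans _ _ (`|M| + 1))//.
  by rewrite (@le_trans _ _ `|M|) ?lerDl// -normrN ler_norm.
have Ni0 : 0 < N^-1 by rewrite invr_gt0.
have := gt0_ltr_powR Ni0 _ _ rM; rewrite !nnegrE powR_ge0 ltW// => /(_ isT isT).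
rewrite -powRrM mulNr divff ?gt_eqF// powR_inv1 ?(ltW M0)// => h.
rewrite powRN ltW// -[ltLHS]invrK ltf_pV2 ?posrE ?invr_gt0 ?powR_gt0//.
Unshelve. all: by end_near. Qed.

(** The power functional turns [b U (r / b)] into [- r^p b^(1/N)], and
    [exp (c / N) >= 1 + c / N]. When [b] is infinite the slope of the functional
    at [0] is [-oo], so the bound persists. *)
Lemma scaled_power_le N (c r : R) (b : \bar R) : 1 < N -> 0 <= r -> 0 <= c ->
  ((expR c)%:E <= b)%E ->
  (scaled (fun u => - u `^ (1 - N^-1))%R b r <=
   (- (r `^ (1 - N^-1) * (1 + c / N)))%R%:E)%E.
Proof.
move=> N1 r0 c0; have N0 : 0 < N by lra.
have Ni0 : 0 < N^-1 by rewrite invr_gt0.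
have Ni1 : N^-1 < 1 by rewrite invf_lt1.
have p0 : 1 - N^-1 != 0 by rewrite gt_eqF; lra.
case: b => [b| |] /=; last by rewrite leeNy_eq.
- rewrite !lee_fin => cb.
  have b0 : 0 < b by rewrite (lt_le_trans _ cb)// expR_gt0.
  rewrite mulrN lerN2 powRM// ?invr_ge0 ?(ltW b0)//.
  rewrite mulrCA ler_wpM2l ?powR_ge0//.
  have -> : b * b^-1 `^ (1 - N^-1) = b `^ N^-1.
    rewrite -powR_inv1 ?(ltW b0)// -powRrM -{1}(powRr1 (ltW b0)).
    rewrite -powRD; last by rewrite [b == 0]gt_eqF// implybT.
    by congr (_ `^ _); ring.
  rewrite (@le_trans _ _ (expR (c / N)))// ?expR_ge1Dx// expRM.
  by apply: ge0_ler_powR; rewrite ?nnegrE ?expR_ge0// ltW.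
- move=> _; rewrite dzero_power//.
  move: r0; rewrite le_eqVlt => /predU1P[<-|r0].
    by rewrite mule0 powR0// mul0r oppr0.
  by rewrite gt0_mulNye ?lte_fin ?leNye.
Qed.

(** At distance [0] both sides are [1], and [beta] is infinite from the distance
    where [a = pi] on; in between, this is the estimate of the cardinal sine
    between [t a] and [a]. *)
Lemma beta_ge N K t (X : metricType R) (x y : X) : 1 < N -> 0 < K ->
  0 < t < 1 ->
  ((expR (K * (1 - t ^+ 2) / 6 * mdist x y ^+ 2))%R%:E <= beta K N t x y)%E.
Proof.
move=> N1 K0 /andP[t0 t1].
have M0 : 0 < N - 1 by lra.
have s0 : 0 < K / (N - 1) by rewrite divr_gt0.
rewrite /beta; set a := Num.sqrt _ * _.
have a0 : 0 <= a by rewrite mulr_ge0// ?sqrtr_ge0 ?mdist_ge0.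
have aE : a ^+ 2 = K / (N - 1) * mdist x y ^+ 2 by rewrite exprMn sqr_sqrtr// ltW.
case: ltP => [_|api]; first by rewrite leey.
case: eqP => [a0'|/eqP an0].
  have : K / (N - 1) * mdist x y ^+ 2 = 0 by rewrite -aE a0' expr0n.
  by move=> /eqP; rewrite mulf_eq0 gt_eqF//= => /eqP ->; rewrite mulr0 expR0.
rewrite (lt_eqF t1); case: eqP => [_|/eqP anpi]; first by rewrite leey.
rewrite (gt_eqF t0) lee_fin.
have {}a0 : 0 < a by rewrite lt_neqAle eq_sym an0.
have {}api : a < pi by rewrite lt_neqAle anpi.
have sa : 0 < sin a by rewrite sin_gt0_pi// a0.
have := @sinc_gaussian_le R (t * a) a; rewrite mulr_gt0// => /(_ isT).
rewrite ler_piMl ?(ltW a0) ?(ltW t1)// => /(_ isT api) h.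
have -> : K * (1 - t ^+ 2) / 6 * mdist x y ^+ 2
    = (a ^+ 2 - (t * a) ^+ 2) / 6 * (N - 1).
  by rewrite [(t * a) ^+ 2]exprMn aE; field; rewrite gt_eqF.
rewrite expRM ge0_ler_powR ?nnegrE ?expR_ge0 ?(ltW M0)//.
  rewrite divr_ge0// ?mulr_ge0 ?(ltW t0) ?(ltW sa)//.
  rewrite sin_ge0_pi// mulr_ge0 ?(ltW a0) ?(ltW t0)//=.
  by rewrite (le_trans _ (ltW api))// ler_piMl ?(ltW a0) ?(ltW t1).
rewrite -ler_pdivlMr ?divr_gt0// in h.
rewrite (le_trans h)// le_eqVlt; apply/orP; left; apply/eqP.
by field; rewrite !gt_eqF.
Qed.

End power_functional.

(** * Mixtures, densities and integrals *)

Section integration.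
Local Open Scope ereal_scope.

Import HBNNSimple.

(** Both integration against a density and disintegration along a kernel are
    mixtures [mu = integral of k x d nu x], whence this common form. It is linear
    in simple functions, and passes to the limit by monotone convergence. *)
Lemma ge0_integral_mixture d1 d2 (S : measurableType d1) (T : measurableType d2)
    (R : realType) (nu : {measure set S -> \bar R})
    (mu : {measure set T -> \bar R}) (k : S -> {measure set T -> \bar R})
    (mk : forall A, measurable A -> measurable_fun setT (fun x => k x A))
    (muE : forall A, measurable A -> mu A = \int[nu]_x k x A)
    (f : T -> \bar R) (f0 : forall y, 0 <= f y) (mf : measurable_fun setT f) :
  \int[mu]_y f y = \int[nu]_x \int[k x]_y f y.
Proof.
pose g := nnsfun_approx measurableT mf.
have gf y : (g n y)%:E @[n --> \oo] --> f y by exact: cvg_nnsfun_approx.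
have ndg y m n : (m <= n)%N -> (g m y <= g n y)%R.
  by move=> mn; exact/lefP/nd_nnsfun_approx.
have mg n r : measurable (g n @^-1` [set r]) by [].
have intE (m : {measure set T -> \bar R}) :
    \int[m]_y f y = limn (sintegral m \o g).
  by rewrite (@nd_ge0_integral_lim _ _ _ m f g).
have ndI (m : {measure set T -> \bar R}) :
    nondecreasing_seq (sintegral m \o g).
  by move=> a b ab; apply: le_sintegral => y; exact: ndg.
have termge0 (m : {measure set T -> \bar R}) n r :
    0 <= r%:E * m (g n @^-1` [set r]).
  apply: (mulemu_ge0 (fun r => g n @^-1` [set r])) => r0.
  exact: preimage_nnfun0.
have mterm n r : measurable_fun setT (fun x => r%:E * k x (g n @^-1` [set r])).
  by apply: measurable_funeM; exact: mk.
have msint n : measurable_fun setT (fun x => sintegral (k x) (g n)).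
  rewrite (_ : (fun x => _) = fun x =>
      \sum_(r \in range (g n)) r%:E * k x (g n @^-1` [set r])); last first.
    by apply/funext => x; rewrite sintegralE.
  by apply: emeasurable_fsum => // r; exact: mterm.
rewrite intE; under eq_integral do rewrite intE.
rewrite monotone_convergence//; last 2 first.
- by move=> n x _; exact: sintegral_ge0.
- by move=> x _; exact: ndI.
congr (limn _); apply/funext => n /=.
rewrite sintegralE; under eq_integral do rewrite sintegralE.
rewrite ge0_integral_fsum//.
apply: eq_fsbigr => r _.
have [r0|r0] := leP 0%R r; last first.
  rewrite preimage_nnfun0// measure0 mule0 integral0_eq// => x _.
  by rewrite measure0 mule0.
rewrite ge0_integralZl//; last exact: mk.
by rewrite muE.
Qed.

(** A mixture of the Dirac masses [rho x * delta_x]. *)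
Lemma ge0_integral_density d (T : measurableType d) (R : realType)
    (nu mu : {measure set T -> \bar R}) (rho : T -> R)
    (mrho : measurable_fun setT rho) (rho0 : forall x, (0 <= rho x)%R)
    (muE : forall A, measurable A -> mu A = \int[nu]_(x in A) (rho x)%:E)
    (f : T -> \bar R) (f0 : forall y, 0 <= f y) (mf : measurable_fun setT f) :
  \int[mu]_y f y = \int[nu]_x ((rho x)%:E * f x).
Proof.
pose k x : {measure set T -> \bar R} := mscale (NngNum (rho0 x)) (dirac x).
have kE x A : k x A = (rho x)%:E * (\1_A x)%:E by [].
rewrite (@ge0_integral_mixture _ _ _ _ _ nu mu k)//; last 2 first.
- move=> A mA; apply: emeasurable_funM; first exact/measurable_EFinP.
  by apply/measurable_EFinP; exact: measurable_indic.
- move=> A mA; rewrite muE// integral_mkcond; apply: eq_integral => x _.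
  rewrite kE patchE indicE; case: ifPn => _; first by rewrite mule1.
  by rewrite mule0.
apply: eq_integral => x _; rewrite ge0_integral_mscale//.
by rewrite integral_dirac// diracT mul1e.
Qed.

(** Uniqueness of the Radon-Nikodym density, tested off the null set that carries
    the singular part. *)
Lemma ae_density d (T : measurableType d) (R : realType)
    (nu mu : probability T R) (rho : T -> R)
    (mrho : measurable_fun setT rho) (rho0 : forall x, (0 <= rho x)%R)
    (muE : forall A, measurable A -> mu A = \int[nu]_(x in A) (rho x)%:E) :
  ae_eq nu setT (EFin \o density nu mu) (EFin \o rho).
Proof.
have [mden den0 [S mS [nS sS]] dE] := lebesgue_decompositionP nu mu.
have off E : measurable E -> \int[nu]_(x in E) (density nu mu x)%:E
    = \int[nu]_(x in E) (rho x)%:E.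
  move=> mE; rewrite (ge0_negligible_integral mS mE)//; last 2 first.
  - by apply: measurable_funTS; exact/measurable_EFinP.
  - by move=> x _; rewrite lee_fin.
  rewrite [RHS](ge0_negligible_integral mS mE)//; last 2 first.
  - by apply: measurable_funTS; exact/measurable_EFinP.
  - by move=> x _; rewrite lee_fin.
  have mES : measurable (E `\` S) by exact: measurableD.
  have := dE _ mES; rewrite muE// => ->.
  rewrite (_ : singular_part nu mu (E `\` S) = 0) ?adde0//.
  by apply: (subset_measure0 _ _ _ sS) => //; exact: measurableC.
have iden : nu.-integrable setT (EFin \o density nu mu).
  apply/integrableP; split; first exact/measurable_EFinP.
  rewrite (eq_integral (fun x => (density nu mu x)%:E)); last first.
    by move=> x _ /=; rewrite ger0_norm.
  by rewrite off// -muE// probability_setT ltry.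
apply: (integral_ae_eq measurableT iden); first exact/measurable_EFinP.
by move=> E _ mE; exact: off.
Qed.

(** Only the part of [mu] that is carried off the null set of the
    Lebesgue decomposition is seen by the density. *)
Lemma ge0_integral_density_le d (T : measurableType d) (R : realType)
    (nu mu : probability T R)
    (f : T -> \bar R) (f0 : forall y, 0 <= f y) (mf : measurable_fun setT f) :
  \int[nu]_x ((density nu mu x)%:E * f x) <= \int[mu]_x f x.
Proof.
have [mden den0 [S mS [nS sS]] dE] := lebesgue_decompositionP nu mu.
have mCS : measurable (~` S) by exact: measurableC.
pose m : {measure set T -> \bar R} := mrestr mu mCS.
rewrite -(@ge0_integral_density _ _ _ nu m)//.
  apply: ge0_le_measure_integral => // A mA.
  by apply: le_measure; rewrite ?inE//; exact: measurableI.
move=> A mA.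
change (mu (A `&` ~` S) = \int[nu]_(x in A) (density nu mu x)%:E).
have mAS : measurable (A `&` ~` S) by exact: measurableI.
rewrite dE// (_ : singular_part nu mu (A `&` ~` S) = 0) ?adde0; last first.
  by apply: (subset_measure0 _ _ _ sS) => //; exact: subIsetr.
rewrite -setDE -ge0_negligible_integral//.
  by apply: measurable_funTS; exact/measurable_EFinP.
by move=> x _; rewrite lee_fin.
Qed.

(** The integral of a nonnegative function is a supremum over the simple functions
    below it, hence monotone among all functions. The integrands built on [beta]
    are compared in this way. *)
Lemma ge0_le_integralT d (T : measurableType d) (R : realType)
    (mu : {measure set T -> \bar R}) (f g : T -> \bar R) :
  (forall x, 0 <= f x) -> (forall x, f x <= g x) ->
  \int[mu]_x f x <= \int[mu]_x g x.
Proof.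
move=> f0 fg; have g0 x : 0 <= g x by exact: le_trans (fg x).
rewrite !ge0_integralTE//; apply: le_ereal_sup => _ [h/= hf <-].
by exists h => // x; exact: le_trans (fg x).
Qed.

Lemma le0_le_integralT d (T : measurableType d) (R : realType)
    (mu : {measure set T -> \bar R}) (f g : T -> \bar R) :
  (forall x, f x <= - g x) -> (forall x, 0 <= g x) ->
  \int[mu]_x f x <= - \int[mu]_x g x.
Proof.
move=> fg g0.
rewrite -[f](_ : (fun x => - - f x) = f); last first.
  by apply/funext => x; rewrite oppeK.
rewrite integral_ge0N; last first.
  by move=> x _; rewrite leeNr oppe0 (le_trans (fg x))// leeNl oppe0.
rewrite leeN2; apply: ge0_le_integralT => // x.
by rewrite leeNr.
Qed.

End integration.

Section density_probability.
Context d (T : measurableType d) (R : realType).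
Local Open Scope ereal_scope.

Lemma ex_density_probability (nu : {measure set T -> \bar R}) (rho : T -> R) :
  measurable_fun setT rho -> (forall x, (0 <= rho x)%R) ->
  \int[nu]_x (rho x)%:E = 1 ->
  exists mu : probability T R,
    forall A, measurable A -> mu A = \int[nu]_(x in A) (rho x)%:E.
Proof.
move=> mrho rho0 rho1.
pose m A := \int[nu]_(x in A) (rho x)%:E.
have m0 : m set0 = 0 by rewrite /m integral_set0.
have mge0 A : 0 <= m A by apply: integral_ge0 => x _; rewrite lee_fin.
have msig : semi_sigma_additive m.
  apply: semi_sigma_additive_nng_induced; first exact/measurable_EFinP.
  by move=> x; rewrite lee_fin.
pose mM := isMeasure.Build _ _ _ m m0 mge0 msig.
pose mm : {measure set T -> \bar R} := HB.pack m mM.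
pose mP := Measure_isProbability.Build _ _ _ mm rho1.
pose mp : probability T R := HB.pack m mM mP.
by exists mp.
Qed.

End density_probability.

(** * Borel structure of compact metric spaces and disintegration *)

Section metric.
Context {R : realType} {X : pmetricType R}.

Lemma measurable_fun_continuous (T : ptopologicalType) (f : T -> R) :
  continuous f -> measurable_fun [set: borel T] f.
Proof.
move=> /continuousP cf; apply: (measurability _ (RGenOpens.measurableE R)).
move=> _ [_ [a [b ->] <-]]; rewrite setTI.
by apply: sub_sigma_algebra; apply: cf; exact: interval_open.
Qed.

Lemma mdist_lipschitz (x y x' y' : X) :
  `|mdist x y - mdist x' y'| <= mdist x x' + mdist y y'.
Proof.
have h (a b a' b' : X) : mdist a b - mdist a' b' <= mdist a a' + mdist b b'.
  rewrite lerBlDr; apply: le_trans (metric_triangle _ a' _) _.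
  rewrite -addrA lerD2l addrC [mdist b b']metric_sym.
  exact: metric_triangle.
rewrite ler_norml h andbT lerNl opprB.
by rewrite [mdist x x']metric_sym [mdist y y']metric_sym h.
Qed.

Lemma continuous_mdist : continuous (fun z : X * X => mdist z.1 z.2).
Proof.
move=> [x y]; apply/cvgrPdist_lt => e e0 /=.
have e2 : 0 < e / 2 by rewrite divr_gt0.
exists (ball x (e / 2), ball y (e / 2)) => /=.
  by split; exact: nbhsx_ballx.
move=> [x' y'] /= []; rewrite !ballEmdist/= => xx' yy'.
by rewrite (le_lt_trans (mdist_lipschitz _ _ _ _))// [e]splitr ltrD.
Qed.

Lemma continuous_lipschitz (f : X -> R) : lipschitz_fun f -> continuous f.
Proof.
move=> [L fL] x; apply/cvgrPdist_lt => e e0.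
pose M := `|L| + 1.
have M0 : 0 < M by rewrite ltr_wpDl.
have eM : 0 < e / M by rewrite divr_gt0.
near=> y.
have : ball x (e / M) y by near: y; exact: nbhsx_ballx.
rewrite ballEmdist/= ltr_pdivlMr// mulrC => h.
rewrite (le_lt_trans (fL _ _))// (le_lt_trans _ h)// ler_wpM2r ?mdist_ge0//.
by rewrite (le_trans (ler_norm _))// lerDl.
Unshelve. all: by end_near. Qed.

Lemma compact_bounded_fun (T : ptopologicalType) (f : T -> R) :
  compact [set: T] -> continuous f -> exists2 B, 0 <= B & forall x, `|f x| <= B.
Proof.
move=> cT cf.
have : compact (f @` setT).
  by apply: continuous_compact => //; exact: continuous_subspaceT.
move=> /compact_bounded[B [Breal hB]].
exists (`|B| + 1) => [|x]; first by rewrite addr_ge0.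
by apply: (hB (`|B| + 1)); [rewrite (le_lt_trans (ler_norm _))// ltrDl|exists x].
Qed.

Context (cX : compact [set: X]).

(** Distances are Borel on the product space, while kernels are handled through the
    product sigma-algebra. A compact metric space is second countable, so an open
    set of the product is a countable union of open rectangles. *)
Lemma measurable_open_prod (W : set (X * X)) : open W ->
  measurable (W : set (borel X * borel X)).
Proof.
move=> oW; have [B cB [Bo Bnbhs]] := compact_second_countable cX.
pose I := [set UV : set X * set X | [/\ B UV.1, B UV.2 & UV.1 `*` UV.2 `<=` W]].
have cI : countable I.
  apply: (@sub_countable _ _ _ (B `*` B)); last exact: countableX.
  by apply: subset_card_le => -[U V] [].
have -> : W = \bigcup_(UV in I) (UV.1 `*` UV.2).
  apply/seteqP; split => [[x y] Wxy|[x y] [UV [_ _ UVW] UVxy]]; last exact: UVW.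
  have [[P Q] /= [Px Qy] PQW] : nbhs (x, y) W by exact: open_nbhs_nbhs.
  have [U [BU Ux] UP] := Bnbhs x P Px.
  have [V [BV Vy] VQ] := Bnbhs y Q Qy.
  exists (U, V) => //; split => //= -[a b] [/= Ua Vb].
  by apply: PQW; split; [exact: UP|exact: VQ].
have /countable_injP[g ginj] := cI.
rewrite -(injpinv_image (cst (setT, setT)) ginj) bigcup_image.
apply: bigcup_measurable => _ [UV IUV <-].
rewrite pinvKV ?inE//; case: IUV => BU BV _.
by apply: measurableX; apply: sub_sigma_algebra; exact: Bo.
Qed.

Lemma measurable_fun_continuous_prod (g : X * X -> R) :
  continuous g -> measurable_fun [set: borel X * borel X] g.
Proof.
move=> /continuousP cg; apply: (measurability _ (RGenOpens.measurableE R)).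
move=> _ [_ [a [b ->] <-]]; rewrite setTI.
by apply: measurable_open_prod; apply: cg; exact: interval_open.
Qed.

Lemma measurable_borel_prod_id :
  measurable_fun [set: borel (X * X)%type]
    (fun z => z : borel X * borel X).
Proof.
apply/measurable_fun_pairP; split; apply: measurable_fun_generators => B oB /=.
  by apply: open_comp => // z _; exact: cvg_fst.
by apply: open_comp => // z _; exact: cvg_snd.
Qed.

End metric.

Section disintegration.
Local Open Scope ereal_scope.

(** Stated along a map [phi] into the product so that it covers the disintegrations
    with respect to both marginals, [phi] being the identity or the swap. *)
Lemma ge0_integral_disintegration d d1 d2 (Z : measurableType d)
    (Y1 : measurableType d1) (Y2 : measurableType d2) (R : realType)
    (P : {measure set Z -> \bar R}) (phi : Z -> Y1 * Y2)
    (mphi : measurable_fun setT phi) (mu : {measure set Y1 -> \bar R})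
    (k : R.-pker Y1 ~> Y2)
    (kE : forall C, measurable C ->
      P (phi @^-1` C) = \int[mu]_y k y (xsection C y))
    (g : Y1 * Y2 -> \bar R) (g0 : forall z, 0 <= g z)
    (mg : measurable_fun setT g) :
  \int[P]_z g (phi z) = \int[mu]_y1 \int[k y1]_y2 g (y1, y2).
Proof.
rewrite -[LHS](ge0_integral_pushforward mphi P measurableT)//.
have mpair (y : Y1) : measurable_fun [set: Y2] (pair y).
  exact: measurable_pair1.
(* the measure structure of the push-forward depends on [mpair], which the
   definition therefore takes as a further argument *)
pose k' y : {measure set (Y1 * Y2)%type -> \bar R} := pushforward (k y) (pair y).
rewrite (@ge0_integral_mixture _ _ _ _ _ mu _ (k' mpair))//; last 2 first.
- move=> A mA.
  rewrite (_ : (fun x => k' mpair x A) = fun x => k x (xsection A x)).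
    by apply: measurable_fun_xsection_finite_kernel; rewrite inE.
  by apply/funext => x; rewrite xsectionE.
- move=> A mA; rewrite [LHS]kE//; apply: eq_integral => x _.
  by rewrite xsectionE.
apply: eq_integral => y _.
by rewrite ge0_integral_pushforward.
Qed.

End disintegration.

Section transport_cost_disintegration.
Context {R : realType} {X : pmetricType R} (cX : compact [set: X]).
Context (mu : probability (borel X) R) (pi : probability (borel (X * X)%type) R)
  (k : R.-pker (borel X) ~> (borel X)).
Local Open Scope ereal_scope.

Let dist2 (z : borel X * borel X) : \bar R :=
  (mdist (z.1 : X) (z.2 : X) ^+ 2)%:E.

Lemma measurable_dist2 : measurable_fun setT dist2.
Proof.
apply/measurable_EFinP; apply: measurable_funX.
exact: (measurable_fun_continuous_prod cX continuous_mdist).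
Qed.

Lemma transport_cost_disintegration_fst : disintegration_fst mu pi k ->
  transport_cost pi = \int[mu]_x \int[k x]_y (mdist (x : X) (y : X) ^+ 2)%:E.
Proof.
move=> kE; rewrite -(@ge0_integral_disintegration _ _ _ _ _ _ _ pi _
  measurable_borel_prod_id mu k _ dist2)//.
- move=> C mC; apply: kE.
  have := @measurable_borel_prod_id R X measurableT C mC.
  by rewrite setTI.
- by move=> z; rewrite lee_fin sqr_ge0.
- exact: measurable_dist2.
Qed.

Lemma transport_cost_disintegration_snd : disintegration_snd mu pi k ->
  transport_cost pi = \int[mu]_x \int[k x]_y (mdist (y : X) (x : X) ^+ 2)%:E.
Proof.
move=> kE.
have msw : measurable_fun [set: borel (X * X)%type]
    (fun z => (z.2, z.1) : borel X * borel X).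
  have /measurable_fun_pairP[m1 m2] := @measurable_borel_prod_id R X.
  exact: measurable_fun_pair.
transitivity (\int[mu]_x \int[k x]_y dist2 (x, y)); last first.
  by apply: eq_integral => x _; apply: eq_integral => y _; rewrite /dist2 metric_sym.
rewrite -(@ge0_integral_disintegration _ _ _ _ _ _ _ pi _ msw mu k _ dist2)//.
- by apply: eq_integral => z _; rewrite /dist2/= metric_sym.
- move=> C mC; have := msw measurableT C mC; rewrite setTI => mC'.
  rewrite [LHS](kE _ mC'); apply: eq_integral => x _; congr (k x _).
- by move=> z; rewrite lee_fin sqr_ge0.
- exact: measurable_dist2.
Qed.

End transport_cost_disintegration.

(** * The descending slope at a fixed scale *)

Section local_slope.
Context {R : realType} {X : pmetricType R}.
Implicit Types (f : X -> R) (x y : X) (n : nat).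

(** The difference quotients defining the descending slope, at the fixed scale
    [1 / (n + 1)]. The value [0] is added so that the supremum is [0] at an
    isolated point. *)
Definition local_slope f n x : \bar R :=
  ereal_sup ([set 0%E] `|`
    [set (Num.max (f x - f y) 0 / mdist x y)%:E |
      y in [set y | 0 < mdist x y < n.+1%:R^-1]]).

Lemma local_slope_ge0 f n x : (0 <= local_slope f n x)%E.
Proof. by apply: ereal_sup_ubound; left. Qed.

Lemma local_slope_le f L n x :
  0 <= L -> (forall x y, `|f x - f y| <= L * mdist x y) ->
  (local_slope f n x <= L%:E)%E.
Proof.
move=> L0 fL; apply: ge_ereal_sup => _ [->|[y /andP[xy _] <-]]; rewrite lee_fin//.
rewrite ler_pdivrMr// (le_trans _ (fL x y))// ge_max normr_ge0 andbT.
exact: ler_norm.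
Qed.

Lemma local_slope_fin_num f n x : lipschitz_fun f ->
  local_slope f n x \is a fin_num.
Proof.
move=> [L fL]; rewrite ge0_fin_numE ?local_slope_ge0//.
apply: (@le_lt_trans _ _ `|L|%:E); last exact: ltry.
apply: local_slope_le => // {}x y; rewrite (le_trans (fL x y))//.
by rewrite ler_wpM2r ?mdist_ge0// ler_norm.
Qed.

Lemma descent_le_local_slope f n x y : lipschitz_fun f ->
  mdist x y < n.+1%:R^-1 ->
  Num.max (f x - f y) 0 <= fine (local_slope f n x) * mdist x y.
Proof.
move=> lf xyn; have [xy0|/eqP xy0] := eqVneq (mdist x y) 0.
  by rewrite (mdist_positivity _ _ xy0) subrr maxxx mdistxx mulr0.
have {}xy0 : 0 < mdist x y.
  by rewrite lt_neqAle eq_sym mdist_ge0 andbT; exact/eqP.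
rewrite -ler_pdivrMr// -lee_fin fineK ?local_slope_fin_num//.
by apply: ereal_sup_ubound; right; exists y => //=; rewrite xy0.
Qed.

(** For a fixed [y], having a quotient above [a] is an open condition on [x]: the
    local slope is lower semicontinuous, hence Borel. *)
Lemma open_local_slope_gt f n (a : R) : continuous f ->
  open [set x | (a%:E < local_slope f n x)%E].
Proof.
move=> cf; have [a0|a0] := ltP a 0.
  rewrite (_ : [set x | _] = setT); first exact: openT.
  by apply/seteqP; split => // x _ /=; apply: lt_le_trans (local_slope_ge0 f n x).
rewrite openE => x /=.
case/ereal_sup_gt => _ [->|[y /andP[xy0 xyn] <-]].
  by rewrite lte_fin ltNge a0.
rewrite lte_fin ltr_pdivlMr// lt_max.
rewrite [X in _ || X]ltNge mulr_ge0 ?(ltW xy0)//= orbF -subr_gt0 => axy.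
have cd : mdist z y @[z --> x] --> mdist x y.
  have cxy : (z, y) @[z --> x] --> ((x, y) : X * X).
    by apply: cvg_pair; [exact: cvg_id|exact: cvg_cst].
  exact: (cvg_comp _ _ cxy (@continuous_mdist R X (x, y))).
have cg : f z - f y - a * mdist z y @[z --> x]
    --> f x - f y - a * mdist x y.
  apply: cvgB; last by apply: cvgM => //; exact: cvg_cst.
  by apply: cvgB; [exact: cf|exact: cvg_cst].
rewrite /interior /=; near=> z => /=.
have zy0 : 0 < mdist z y by near: z; exact: (cvgr_gt _ cd).
have zyn : mdist z y < n.+1%:R^-1 by near: z; exact: (cvgr_lt _ cd).
apply: (@lt_le_trans _ _ (Num.max (f z - f y) 0 / mdist z y)%:E).
  rewrite lte_fin ltr_pdivlMr// lt_max -subr_gt0; apply/orP; left.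
  by near: z; exact: (cvgr_gt _ cg).
by apply: ereal_sup_ubound; right; exists y => //=; rewrite zy0.
Unshelve. all: by end_near. Qed.

Lemma measurable_local_slope f n : continuous f ->
  measurable_fun [set: borel X] (local_slope f n).
Proof.
move=> cf; apply: (measurability _ (ErealGenOInfty.measurableE R)).
move=> _ [_ [a ->] <-]; rewrite setTI preimage_itvoy.
by apply: sub_sigma_algebra; exact: open_local_slope_gt.
Qed.

(** The punctured balls form a basis of the punctured neighborhoods, so the upper
    limit is the decreasing limit of the suprema. *)
Lemma cvg_local_slope f x :
  local_slope f n x @[n --> \oo] --> descending_slope f x.
Proof.
have ni : nonincreasing_seq (fun n => local_slope f n x).
  move=> m n mn; apply: ereal_sup_le => _ [->|[y /andP[xy xyn] <-]]; first by left.
  right; exists y => //=; rewrite xy (lt_le_trans xyn)//.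
  by rewrite lef_pV2 ?posrE// ler_nat ltnS.
have ball_n (A : set X) : nbhs x A ->
    exists n, forall y, mdist x y < n.+1%:R^-1 -> A y.
  move=> /nbhs_ballP[e /= e0 eA].
  exists (Num.truncn e^-1) => y xy; apply: eA; rewrite ballEmdist/=.
  apply: lt_trans xy _; rewrite -[ltRHS]invrK ltf_pV2 ?posrE ?invr_gt0//.
  by rewrite truncnS_gt.
suff <- : ereal_inf (range (fun n => local_slope f n x)) = descending_slope f x.
  exact: ereal_nonincreasing_cvgn.
rewrite /descending_slope; case: asboolP => [[_ [V Vx VE]]|niso].
  apply/eqP; rewrite eq_le; apply/andP; split; last first.
    by apply: le_ereal_inf_tmp => _ [n _ <-]; exact: local_slope_ge0.
  have [n hn] := ball_n V Vx.
  apply: ge_ereal_inf; exists (local_slope f n x); first by exists n.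
  apply: ge_ereal_sup => _ [->//|[y /andP[xy0 xyn] <-]].
  have : (V `&` setT) y by split => //; exact: hn.
  by rewrite VE => /= yx; move: xy0; rewrite yx mdistxx ltxx.
apply/eqP; rewrite eq_le; apply/andP; split.
  apply: le_ereal_inf_tmp => _ [V xV <-].
  have [n hn] := ball_n _ xV.
  have [y [yx Vy]] : exists y, y != x /\ V y.
    apply: contrapT => nV; apply: niso; split; first by rewrite inE.
    exists (fun y => y != x -> V y) => //.
    rewrite setIT; apply/seteqP; split => [y yV|y ->/=]; last by rewrite eqxx.
    apply: contrapT => /eqP yx; apply: nV; exists y; split => //; exact: yV.
  apply: ge_ereal_inf; exists (local_slope f n x); first by exists n.
  apply: ge_ereal_sup => _ [->|[z /andP[xz0 xzn] <-]].
    apply: (@le_trans _ _ (Num.max (f x - f y) 0 / mdist x y)%:E).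
      by rewrite lee_fin divr_ge0 ?mdist_ge0// le_max lexx orbT.
    by apply: ereal_sup_ubound; exists y.
  apply: ereal_sup_ubound; exists z => //; apply: hn => //.
  by rewrite eq_sym -mdist_gt0.
apply: le_ereal_inf_tmp => _ [n _ <-].
apply: ge_ereal_inf.
exists (ereal_sup [set (Num.max (f x - f y) 0 / mdist x y)%:E |
    y in [set y | 0 < mdist x y < n.+1%:R^-1]]).
  exists [set y | 0 < mdist x y < n.+1%:R^-1] => //.
  rewrite /dnbhs /within /=; near=> y => yx /=.
  rewrite mdist_gt0 eq_sym yx/=.
  have : ball x n.+1%:R^-1 y by near: y; exact: nbhsx_ballx.
  by rewrite ballEmdist.
by apply: ereal_sup_le => _ [y hy <-]; right; exists y.
Unshelve. all: by end_near. Qed.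

End local_slope.

(** * Displacement convexity of the power entropy *)

Section entropy_bounds.
Context d (T : measurableType d) (R : realType) (N : R).
Let p := 1 - N^-1.
Local Open Scope ereal_scope.

(** The lower bound [exp (c e) <= b] on the distortion is used through
    [b^(1/N) >= 1 + c e / N], and [sigma^p >= q sigma] turns the weight in front
    of [e] into the measure [mu] itself, so that the mixture is the integral of
    [e] against the plan. *)
Lemma integral_scaled_power_le (c q : R) (nu mu : probability T R)
    (sigma : T -> R) (k : R.-pker T ~> T) (b : T -> T -> \bar R)
    (e : T * T -> R) :
  (1 < N)%R -> (0 <= c)%R -> (0 <= q)%R ->
  measurable_fun setT sigma -> (forall x, (0 <= sigma x)%R) ->
  (forall A, measurable A -> mu A = \int[nu]_(x in A) (sigma x)%:E) ->
  (forall x, (q * sigma x <= sigma x `^ p)%R) ->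
  measurable_fun setT e -> (forall z, (0 <= e z)%R) ->
  (forall x y, (expR (c * e (x, y)))%:E <= b x y) ->
  \int[nu]_x \int[k x]_y
      scaled (fun r => - r `^ p)%R (b x y) (density nu mu x) <=
  - (\int[nu]_x (sigma x `^ p)%:E +
     (q * (c / N))%:E * \int[mu]_x \int[k x]_y (e (x, y))%:E).
Proof.
move=> N1 c0 q0 ms s0 muE qs me e0 eb.
have N0 : (0 < N)%R by lra.
have cN0 : (0 <= c / N)%R by rewrite divr_ge0// ltW.
pose h x := \int[k x]_y (e (x, y))%:E.
have h0 x : 0 <= h x by apply: integral_ge0 => y _; rewrite lee_fin.
have mh : measurable_fun setT h.
  apply: (measurable_fun_integral_finite_kernel (EFin \o e)).
    by move=> z; rewrite /= lee_fin.
  exact/measurable_EFinP.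
have me2 x : measurable_fun setT (fun y => (e (x, y))%:E).
  apply: (@measurable_fun_pair2 _ _ _ _ _ _ (EFin \o e) x).
  exact/measurable_EFinP.
have [mrho rho0 _ _] := lebesgue_decompositionP nu mu.
set rho := density nu mu in mrho rho0 *.
have inner x : \int[k x]_y scaled (fun r => - r `^ p)%R (b x y) (rho x) <=
    - ((rho x `^ p)%:E * (1 + (c / N)%:E * h x)).
  have kh : \int[k x]_y (rho x `^ p * (1 + c * e (x, y) / N))%:E =
      (rho x `^ p)%:E * (1 + (c / N)%:E * h x).
    under eq_integral => y _ do rewrite EFinM EFinD mulrAC EFinM.
    rewrite ge0_integralZl//; last 2 first.
    - by move=> y _; rewrite adde_ge0// mule_ge0// lee_fin.
    - by rewrite lee_fin powR_ge0.
    - rewrite ge0_integralD//; last 2 first.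
      + by move=> y _; rewrite mule_ge0// lee_fin.
      + exact: measurable_funeM.
      rewrite ge0_integralZl//; last by move=> y _; rewrite lee_fin.
      by rewrite integral_cst// mul1e prob_kernel.
    - apply: emeasurable_funD; first exact: measurable_cst.
      exact: measurable_funeM.
  rewrite -kh; apply: le0_le_integralT => y.
    rewrite -EFinN; apply: scaled_power_le => //.
    by rewrite mulr_ge0.
  by rewrite lee_fin mulr_ge0 ?powR_ge0// addr_ge0// divr_ge0 ?mulr_ge0// ltW.
have g0 (r : T -> R) x : 0 <= (r x `^ p)%:E * (1 + (c / N)%:E * h x).
  by rewrite mule_ge0 ?lee_fin ?powR_ge0// adde_ge0// mule_ge0.
have mg (r : T -> R) : measurable_fun setT r ->
    measurable_fun setT (fun x => (r x `^ p)%:E * (1 + (c / N)%:E * h x)).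
  move=> mr; apply: emeasurable_funM.
    apply/measurable_EFinP.
    exact: (measurableT_comp (measurable_powR p) mr).
  by apply: emeasurable_funD => //; exact: measurable_funeM.
apply: (@le_trans _ _
    (- \int[nu]_x ((rho x `^ p)%:E * (1 + (c / N)%:E * h x)))).
  by apply: le0_le_integralT => // x; exact: (g0 rho).
rewrite leeN2.
have -> : \int[nu]_x ((rho x `^ p)%:E * (1 + (c / N)%:E * h x)) =
    \int[nu]_x ((sigma x `^ p)%:E * (1 + (c / N)%:E * h x)).
  apply: ge0_ae_eq_integral => //; [exact: mg|exact: mg|].
  apply: filterS (ae_density ms s0 muE) => x /(_ Logic.I)/= [rs] _.
  by rewrite /rho rs.
rewrite (ge0_integral_density ms s0 muE h0 mh).
have msp : measurable_fun setT (fun x => (sigma x `^ p)%:E).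
  by apply/measurable_EFinP; exact: (measurableT_comp (measurable_powR p) ms).
have msh : measurable_fun setT (fun x => (sigma x)%:E * h x).
  by apply: emeasurable_funM => //; exact/measurable_EFinP.
have qcN0 : (0 <= q * (c / N))%R by rewrite mulr_ge0.
rewrite -ge0_integralZl//; last by move=> x _; rewrite mule_ge0// lee_fin.
rewrite -ge0_integralD//; last 3 first.
- by move=> x _; rewrite lee_fin powR_ge0.
- by move=> x _; rewrite !mule_ge0// lee_fin.
- exact: measurable_funeM.
apply: ge0_le_integralT => x.
  by rewrite adde_ge0 ?lee_fin ?powR_ge0// !mule_ge0// lee_fin.
rewrite [leRHS]ge0_muleDr//; last by apply: mule_ge0; rewrite ?lee_fin.
rewrite mule1 leeD2l// !muleA -!EFinM lee_wpmul2r// lee_fin.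
by rewrite mulrAC ler_wpM2r.
Qed.

(** Integrated tangent inequality at [sigma]; [mu] dominates its absolutely
    continuous part, which is all that the density sees. *)
Lemma integral_density_powR_le (nu mu : probability T R) (sigma : T -> R) :
  (1 < N)%R -> measurable_fun setT sigma -> (forall x, (0 < sigma x)%R) ->
  \int[nu]_x (density nu mu x `^ p)%:E <=
  (1 - p)%:E * \int[nu]_x (sigma x `^ p)%:E +
  p%:E * \int[mu]_x (sigma x `^ (p - 1))%:E.
Proof.
move=> N1 ms s0.
have [mrho rho0 _ _] := lebesgue_decompositionP nu mu.
have Ni0 : (0 < N^-1)%R by rewrite invr_gt0; lra.
have Ni1 : (N^-1 < 1)%R by rewrite invf_lt1//; lra.
have p01 : (0 < p < 1)%R by rewrite /p; lra.
have mpow a (r : T -> R) : measurable_fun setT r ->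
    measurable_fun setT (fun x => (r x `^ a)%:E).
  by move=> mr; apply/measurable_EFinP; exact: (measurableT_comp (measurable_powR a) mr).
have p0 : (0 <= p)%R by lra.
have p1 : (0 <= 1 - p)%R by lra.
have pos a x : 0 <= (sigma x `^ a)%:E by rewrite lee_fin powR_ge0.
have m1 : measurable_fun setT
    (fun x => (density nu mu x)%:E * (sigma x `^ (p - 1))%:E).
  by apply: emeasurable_funM; [exact/measurable_EFinP|exact: mpow].
have pos2 x : 0 <= (density nu mu x)%:E * (sigma x `^ (p - 1))%:E.
  by rewrite mule_ge0// lee_fin.
apply: (@le_trans _ _ ((1 - p)%:E * \int[nu]_x (sigma x `^ p)%:E + p%:E *
    \int[nu]_x ((density nu mu x)%:E * (sigma x `^ (p - 1))%:E))); last first.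
  rewrite leeD2l// lee_wpmul2l ?lee_fin//.
  by apply: ge0_integral_density_le => //; exact: mpow.
rewrite -!ge0_integralZl//; last exact: mpow.
rewrite -ge0_integralD//; last 4 first.
- by move=> x _; rewrite mule_ge0// lee_fin.
- by apply: measurable_funeM; exact: mpow.
- by move=> x _; rewrite mule_ge0// lee_fin.
- exact: measurable_funeM.
apply: ge0_le_integralT => x; first by rewrite lee_fin powR_ge0.
rewrite -!EFinM -EFinD lee_fin [(density _ _ _ * _)%R]mulrC.
exact: powR_tangent.
Qed.

End entropy_bounds.

Section displacement.
Context {R : realType} {X : pmetricType R} (N K : R).
Context (nu : probability (borel X) R).
Let p := 1 - N^-1.
Local Open Scope ereal_scope.

(** The curvature inequality for the power functional, with every distortion
    coefficient bounded below and the entropy at time [t] linearized. *)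
Lemma power_displacement_convexity (mu : probability (borel X) R) (sigma : X -> R)
    (q : R) (Pi : probability (borel (geodesic X)) R)
    (k0 k1 : R.-pker (borel X) ~> (borel X)) (t : {i01 R}) :
  let plan := distribution Pi (@endpoints R X) in
  let s := t%:num in
  compact [set: X] -> (1 < N)%R -> (0 < K)%R -> (0 <= q)%R ->
  measurable_fun [set: borel X] sigma -> (forall x, (0 < sigma x)%R) ->
  (forall A, measurable A -> mu A = \int[nu]_(x in A) (sigma x)%:E) ->
  (forall x, (q * sigma x <= sigma x `^ p)%R) ->
  disintegration_fst mu plan k0 -> disintegration_snd nu plan k1 ->
  (0 < s < 1)%R ->
  (let U := (fun r => - r `^ p)%R in
   U_functional U nu (distribution Pi (@eval_geodesic R X t)) <=
        (1 - s)%:E *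
          \int[nu]_x0 \int[k0 x0]_x1
            scaled U (beta K N (1 - s) (x0 : X) (x1 : X)) (density nu mu x0)
        + s%:E *
          \int[nu]_x1 \int[k1 x1]_x0
            scaled U (beta K N s (x0 : X) (x1 : X)) (density nu nu x1)
        + dinfty U * ((1 - s)%:E * singular_part nu mu setT
                      + s%:E * singular_part nu nu setT)) ->
  (1 - s)%:E * (\int[nu]_x (sigma x `^ p)%:E +
      (q * (K * (1 - (1 - s) ^+ 2) / 6 / N))%:E * transport_cost plan) +
    s%:E * (1 + (K * (1 - s ^+ 2) / 6 / N)%:E * transport_cost plan) <=
  (1 - p)%:E * \int[nu]_x (sigma x `^ p)%:E +
    p%:E * \int[Pi]_c (sigma (eval_geodesic t c) `^ (p - 1))%:E.
Proof.
move=> plan s cX N1 K0 q0 ms s0 muE qs dis0 dis1 /andP[t0 t1] /=.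
set U := (fun r => - r `^ p)%R.
have s2 : (0 <= s ^+ 2 <= 1)%R.
  by rewrite sqr_ge0/= expr_le1// ltW.
have s2' : (0 <= (1 - s) ^+ 2 <= 1)%R.
  by rewrite sqr_ge0/= expr_le1//; lra.
have N0 : (0 < N)%R by lra.
have s'0 : (0 <= 1 - s)%R by lra.
have c0 : (0 <= K * (1 - (1 - s) ^+ 2) / 6)%R.
  by rewrite divr_ge0// mulr_ge0 ?(ltW K0)// subr_ge0; lra.
have c1 : (0 <= K * (1 - s ^+ 2) / 6)%R.
  by rewrite divr_ge0// mulr_ge0 ?(ltW K0)// subr_ge0; lra.
have c0N : (0 <= q * (K * (1 - (1 - s) ^+ 2) / 6 / N))%R.
  by rewrite mulr_ge0// divr_ge0// ltW.
have c1N : (0 <= K * (1 - s ^+ 2) / 6 / N)%R by rewrite divr_ge0// ltW.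
have md (z : borel X * borel X -> R) : z = (fun z => mdist (z.1 : X) (z.2 : X) ^+ 2)%R ->
    measurable_fun setT z.
  move=> ->; apply: measurable_funX.
  exact: (measurable_fun_continuous_prod cX continuous_mdist).
rewrite /U_functional dinfty_power// !mul0e !adde0.
set L := \int[nu]_x _; set R0 := \int[nu]_x0 _; set R1 := \int[nu]_x1 _.
move=> LR.
set I := \int[nu]_x (sigma x `^ p)%:E; set D := transport_cost plan.
set J := \int[Pi]_c _.
have R0le : R0 <= - (I + (q * (K * (1 - (1 - s) ^+ 2) / 6 / N))%:E * D).
  rewrite /D (transport_cost_disintegration_fst cX dis0).
  apply: (@integral_scaled_power_le _ _ R N _ q nu mu sigma k0 _
    (fun z => mdist (z.1 : X) (z.2 : X) ^+ 2)%R) => //.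
  - by move=> x; exact: ltW.
  - exact: md.
  - by move=> z; rewrite sqr_ge0.
  - by move=> x y /=; apply: beta_ge => //; lra.
have nuE A : measurable A -> nu A = \int[nu]_(x in A) (1%R)%:E.
  by move=> mA; rewrite integral_cst// mul1e.
have R1le : R1 <= - (1 + (K * (1 - s ^+ 2) / 6 / N)%:E * D).
  rewrite /D (transport_cost_disintegration_snd cX dis1).
  have -> : 1 = \int[nu]_x ((1%R : R) `^ p)%:E.
    by rewrite powR1 integral_cst// mul1e [RHS]probability_setT.
  rewrite -[X in X%:E * _]mul1r.
  apply: (@integral_scaled_power_le _ _ R N _ 1%R nu nu (fun=> 1%R) k1
    (fun x1 x0 => beta K N s (x0 : X) (x1 : X))
    (fun z => mdist (z.2 : X) (z.1 : X) ^+ 2)%R) => //.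
  - by move=> x; rewrite powR1 mulr1.
  - by apply: md; apply/funext => z; rewrite metric_sym.
  - by move=> z; rewrite sqr_ge0.
  - by move=> x y /=; apply: beta_ge => //; lra.
have Lge : - ((1 - p)%:E * I + p%:E * J) <= L.
  have -> : L = - \int[nu]_x
      (density nu (distribution Pi (@eval_geodesic R X t)) x `^ p)%:E.
    rewrite -integral_ge0N//; last by move=> x _; rewrite lee_fin powR_ge0.
  rewrite leeN2.
  have := integral_density_powR_le nu
    (distribution Pi (@eval_geodesic R X t)) N1 ms s0.
  rewrite ge0_integral_distribution//; last 2 first.
  - apply/measurable_EFinP.
    exact: (measurableT_comp (measurable_powR (p - 1)) ms).
  - by move=> x; rewrite lee_fin powR_ge0.
have := le_trans Lge LR.
have D0 : 0 <= D by apply: integral_ge0 => z _; rewrite lee_fin sqr_ge0.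
have I0 : 0 <= I by apply: integral_ge0 => z _; rewrite lee_fin powR_ge0.
move=> {}LR; rewrite -leeN2; apply: le_trans LR _.
rewrite oppeD; last first.
  apply: ge0_adde_def; rewrite inE.
    by apply: mule_ge0; [rewrite lee_fin|apply: adde_ge0 => //; exact: mule_ge0].
  apply: mule_ge0; first by rewrite lee_fin ltW.
  by apply: adde_ge0 => //; exact: mule_ge0.
rewrite -!muleN; apply: leeD.
  by apply: lee_wpmul2l => //; rewrite lee_fin.
by apply: lee_wpmul2l => //; rewrite lee_fin ltW.
Qed.

End displacement.

(** * Slopes along geodesics *)

Section geodesic_estimates.
Context {R : realType} {X : pmetricType R}.
Local Open Scope ereal_scope.

Lemma ge0_integral_start (mu mu1 : probability (borel X) R)
    (Pi : probability (borel (geodesic X)) R) (h : borel X -> \bar R) :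
  transference_plan mu mu1 (distribution Pi (@endpoints R X)) ->
  measurable_fun setT h -> (forall x, 0 <= h x) ->
  \int[Pi]_c h (eval_geodesic 0%R%:i01 c) = \int[mu]_x h x.
Proof.
move=> tp mh h0.
rewrite -(ge0_integral_distribution (@eval_geodesic R X 0%R%:i01) mh h0).
apply: eq_measure_integral => A mA _.
transitivity (distribution Pi (@endpoints R X) (A `*` [set: X])).
  2: exact: (tp A mA).1.
rewrite /distribution /pushforward; congr (Pi _).
by apply/seteqP; split => [c Ac|c [Ac _]].
Qed.

Lemma mdist_start_geodesic (c : borel (geodesic X)) (t : {i01 R}) :
  mdist (eval_geodesic 0%R%:i01 c : X) (eval_geodesic t c : X) =
  (t%:num * mdist ((endpoints c).1 : X) ((endpoints c).2 : X))%R.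
Proof.
have cmin : minimizing_geodesic (set_val (c : geodesic X)) by exact: set_valP.
have := cmin 0%R%:i01 t; rewrite /= sub0r normrN ger0_norm => [|//].
exact.
Qed.

(** Along a geodesic, [sigma^(p-1)] grows at most like the descent of [f], which is
    at most its local slope at the starting point times [t d]; Young's inequality
    with parameter [A] then separates the slope, at a point of law [mu], from
    [d^2]. *)
Lemma integral_powR_geodesic_le (N eps eta A : R) (f : X -> R) (n : nat)
    (nu mu mu1 : probability (borel X) R)
    (Pi : probability (borel (geodesic X)) R) (t : {i01 R}) :
  let plan := distribution Pi (@endpoints R X) in
  let sigma x := (1 + eps * f x)%R in
  let p := (1 - N^-1)%R in
  let q := (1 - 3 * eta)%R in
  compact [set: X] -> (1 < N)%R -> (0 < eta < 3^-1)%R -> (0 <= eps)%R -> (0 < A)%R ->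
  lipschitz_fun f ->
  (forall x, (`|eps * f x| <= eta)%R) ->
  (forall A, measurable A -> mu A = \int[nu]_(x in A) (sigma x)%:E) ->
  transference_plan mu mu1 plan ->
  (forall x y : X, (t%:num * mdist x y < n.+1%:R^-1)%R) ->
  \int[Pi]_c (sigma (eval_geodesic t c) `^ (p - 1))%:E <=
  \int[nu]_x (sigma x `^ p)%:E +
  (N^-1 / q * (eps * t%:num))%:E *
    (A%:E * (q^-1%:E * \int[nu]_x (local_slope f n x ^+ 2)) +
     (4 * A)^-1%:E * transport_cost plan).
Proof.
move=> plan sigma p q cX N1 eta01 e0 A0 lf fe muE tp tn.
have [eta0 eta1] := andP eta01.
have q0 : (0 < q)%R by rewrite /q; lra.
have Ni0 : (0 < N^-1)%R by rewrite invr_gt0; lra.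
have Ni1 : (N^-1 < 1)%R by rewrite invf_lt1//; lra.
have cf := continuous_lipschitz lf.
have mf : measurable_fun [set: borel X] f by exact: measurable_fun_continuous.
have ms : measurable_fun [set: borel X] sigma.
  by apply: measurable_funD => //; exact: measurable_funM.
have sI x : (1 - eta <= sigma x <= 1 + eta)%R.
  by have := fe x; rewrite ler_norml /sigma => /andP[? ?]; apply/andP; split; lra.
have s0 x : (0 < sigma x)%R by have := sI x; lra.
pose G x := fine (local_slope f n x).
have G0 x : (0 <= G x)%R by rewrite fine_ge0// local_slope_ge0.
have GE x : local_slope f n x = (G x)%:E by rewrite fineK// local_slope_fin_num.
have mG : measurable_fun [set: borel X] G.
  apply: measurableT_comp (measurable_local_slope n cf).
  exact: fine_measurable.
have mG2 : measurable_fun [set: borel X] (fun x => (G x ^+ 2)%:E).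
  by apply/measurable_EFinP; exact: measurable_funX.
pose psi x := (sigma x `^ (p - 1))%:E.
have psi0 x : 0 <= psi x by rewrite lee_fin powR_ge0.
have mpsi : measurable_fun [set: borel X] psi.
  apply/measurable_EFinP; exact: (measurableT_comp (measurable_powR (p - 1)) ms).
pose D2 (c : borel (geodesic X)) :=
  (mdist ((endpoints c).1 : X) ((endpoints c).2 : X) ^+ 2)%:E : \bar R.
have mdz : measurable_fun [set: borel (X * X)%type]
    (fun z => (mdist (z.1 : X) (z.2 : X) ^+ 2)%:E).
  exact: (measurableT_comp (measurable_dist2 cX) (@measurable_borel_prod_id R X)).
have mD2 : measurable_fun setT D2.
  exact: (measurableT_comp mdz (measurable_endpoints (X := X))).
have D20 c : 0 <= D2 c by rewrite lee_fin sqr_ge0.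
have intD2 : \int[Pi]_c D2 c = transport_cost plan.
  rewrite /transport_cost /plan ge0_integral_distribution// => z.
  by rewrite lee_fin sqr_ge0.
have -> : \int[nu]_x (sigma x `^ p)%:E =
    \int[Pi]_c psi (eval_geodesic 0%R%:i01 c).
  rewrite (ge0_integral_start tp mpsi psi0).
  rewrite (ge0_integral_density ms (fun x => ltW (s0 x)) muE psi0 mpsi).
  apply: eq_integral => x _; rewrite -EFinM mulr_powRB1// ?ltW// /p; lra.
have intG : \int[Pi]_c (G (eval_geodesic 0%R%:i01 c) ^+ 2)%:E <=
    q^-1%:E * \int[nu]_x (local_slope f n x ^+ 2).
  rewrite (ge0_integral_start tp mG2); last by move=> x; rewrite lee_fin sqr_ge0.
  rewrite (ge0_integral_density ms (fun x => ltW (s0 x)) muE _ mG2); last first.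
    by move=> x; rewrite lee_fin sqr_ge0.
  under [in leRHS]eq_integral => x _ do rewrite GE -EFin_expe.
  rewrite -ge0_integralZl//; last 2 first.
  - by move=> x _; rewrite lee_fin sqr_ge0.
  - by rewrite lee_fin invr_ge0 ltW.
  apply: ge0_le_integralT => x; first by rewrite mule_ge0 ?lee_fin ?sqr_ge0// ltW.
  rewrite -!EFinM lee_fin ler_wpM2r ?sqr_ge0//.
  rewrite -[leRHS]mul1r ler_pdivlMr//.
  have := sI x; rewrite /q => /andP[_ h].
  rewrite (@le_trans _ _ ((1 + eta) * (1 - 3 * eta))%R)//.
    by rewrite ler_wpM2r//; lra.
  by have := sqr_ge0 eta; rewrite expr2; lra.
pose C := (N^-1 / q * (eps * t%:num))%R.
have C0 : (0 <= C)%R.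
  by rewrite /C !mulr_ge0// ?invr_ge0 ?(ltW q0)//; lra.
have Ai0 : (0 <= (4 * A)^-1)%R by rewrite invr_ge0; lra.
apply: (@le_trans _ _ (\int[Pi]_c (psi (eval_geodesic 0%R%:i01 c) +
   C%:E * (A%:E * (G (eval_geodesic 0%R%:i01 c) ^+ 2)%:E + (4 * A)^-1%:E * D2 c)))).
  apply: ge0_le_integralT => c; first exact: psi0.
  rewrite /psi /D2 -!EFinM -EFinD lee_fin.
  set x := eval_geodesic 0%R%:i01 c; set y := eval_geodesic t c.
  set l := mdist (endpoints c).1 (endpoints c).2.
  have pI : (-1 <= p - 1 <= 0)%R by rewrite /p; lra.
  have h1 := powR_slope_near1 eta01 pI (sI x) (sI y).
  rewrite -lerBlDl; apply: (le_trans h1).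
  have -> : (- (p - 1) / (1 - 3 * eta) = N^-1 / q)%R.
    by rewrite /p opprB subKr.
  have -> : (Num.max (sigma x - sigma y) 0 = eps * Num.max (f x - f y) 0)%R.
    rewrite maxr_pMr// mulr0; congr Num.max; rewrite /sigma; ring.
  have Nq0 : (0 <= N^-1 / q)%R by rewrite divr_ge0 ?(ltW q0, ltW Ni0).
  rewrite /C -[leRHS]mulrA ler_wpM2l// -[leRHS]mulrA ler_wpM2l//.
  have xy : (mdist (x : X) (y : X) = t%:num * l)%R := mdist_start_geodesic c t.
  have := @descent_le_local_slope R X f n x y lf.
  rewrite xy => /(_ (tn _ _)) /le_trans; apply.
  rewrite -/(G x) mulrCA ler_wpM2l//.
  rewrite -subr_ge0.
  (* completing the square in Young's inequality *)
  have -> : (A * G x ^+ 2 + (4 * A)^-1 * l ^+ 2 - G x * l =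
      A * (G x - l / (2 * A)) ^+ 2)%R by field; rewrite gt_eqF.
  by rewrite mulr_ge0 ?sqr_ge0// ltW.
have m0 : measurable_fun setT (fun c => psi (eval_geodesic 0%R%:i01 c)).
  exact: (measurableT_comp mpsi (@measurable_eval_geodesic R X 0%R%:i01)).
have m1 : measurable_fun setT (fun c => (G (eval_geodesic 0%R%:i01 c) ^+ 2)%:E).
  exact: (measurableT_comp mG2 (@measurable_eval_geodesic R X 0%R%:i01)).
have nn1 c : 0 <= A%:E * (G (eval_geodesic 0%R%:i01 c) ^+ 2)%:E.
  by rewrite mule_ge0// lee_fin ?sqr_ge0// ltW.
have nn2 c : 0 <= (4 * A)^-1%:E * D2 c by rewrite mule_ge0// lee_fin.
have mm1 : measurable_fun setT
    (fun c => A%:E * (G (eval_geodesic 0%R%:i01 c) ^+ 2)%:E).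
  exact: measurable_funeM.
have mm2 : measurable_fun setT (fun c => (4 * A)^-1%:E * D2 c).
  exact: measurable_funeM.
rewrite ge0_integralD//; last 2 first.
- by move=> c _; apply: mule_ge0; [rewrite lee_fin|exact: adde_ge0].
- by apply: measurable_funeM; exact: emeasurable_funD.
rewrite leeD2l//.
have mS : measurable_fun setT (fun c =>
    A%:E * (G (eval_geodesic 0%R%:i01 c) ^+ 2)%:E + (4 * A)^-1%:E * D2 c).
  exact: emeasurable_funD.
have S0 c : setT c -> 0 <=
    A%:E * (G (eval_geodesic 0%R%:i01 c) ^+ 2)%:E + (4 * A)^-1%:E * D2 c.
  by move=> _; exact: adde_ge0.
rewrite (ge0_integralZl Pi measurableT mS S0) ?lee_fin//.
apply: lee_wpmul2l; first by rewrite lee_fin.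
rewrite ge0_integralD//.
have G20 c : setT c -> 0 <= (G (eval_geodesic 0%R%:i01 c) ^+ 2)%:E.
  by rewrite lee_fin sqr_ge0.
rewrite (ge0_integralZl Pi measurableT m1 G20) ?lee_fin ?(ltW A0)//.
rewrite (ge0_integralZl Pi measurableT mD2 (fun c _ => D20 c)) ?lee_fin//.
by rewrite intD2 leeD2r// lee_wpmul2l// lee_fin ltW.
Qed.

End geodesic_estimates.

(** * The spectral gap *)

Section arithmetic.
Context {R : realType}.

(** The coefficient [A] of the Young inequality is chosen so that its [D]-term is
    exactly [3 q^2 (K / (6 N)) D], which is bounded by the [D]-term of the
    displacement inequality; dividing by [s] and by [e^2] leaves [F] and [S]. *)
Lemma spectral_gap_arith (N K q s e I D J S F : R) :
  1 < N -> 0 < K -> 0 < q -> q <= 1 -> 0 < s -> 2 * q <= (1 - s) * (2 - s) ->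
  q <= 1 - s ^+ 2 -> 0 < e -> 0 <= D ->
  let p := 1 - N^-1 in
  let A := p * e / (2 * K * q ^+ 3) in
  (1 - s) * (I + q * (K * (1 - (1 - s) ^+ 2) / 6 / N) * D) +
    s * (1 + K * (1 - s ^+ 2) / 6 / N * D) <= (1 - p) * I + p * J ->
  J <= I + N^-1 / q * (e * s) * (A * (q^-1 * S) + (4 * A)^-1 * D) ->
  I + q * (p * (1 - p) / 2) * (e ^+ 2 * F) <= 1 ->
  q ^+ 6 * F <= (N - 1) / (K * N) * S.
Proof.
move=> N1 K0 q0 q1 s0 hs1 hs2 e0 D0 p A h1 h2 h3.
have N0 : 0 < N by lra.
have Ni0 : 0 < N^-1 by rewrite invr_gt0.
have Ni1 : N^-1 < 1 by rewrite invf_lt1.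
have p0 : 0 < p by rewrite /p; lra.
have A0 : 0 < A by rewrite /A divr_gt0 ?mulr_gt0// exprn_gt0.
set c := K / (6 * N).
have c0 : 0 < c by rewrite divr_gt0// mulr_gt0.
have cD0 : 0 <= c * D by rewrite mulr_ge0// ltW.
have e1 : q * (K * (1 - (1 - s) ^+ 2) / 6 / N) * D = q * (s * (2 - s)) * (c * D).
  by rewrite /c; field; rewrite gt_eqF.
have e2 : K * (1 - s ^+ 2) / 6 / N * D = (1 - s ^+ 2) * (c * D).
  by rewrite /c; field; rewrite gt_eqF.
rewrite {}e1 {}e2 in h1.
set T := A * (q^-1 * S) + (4 * A)^-1 * D in h2.
have h2' : p * J <= p * I + s * (p * (N^-1 / q * e) * T).
  by have := ler_wpM2l (ltW p0) h2; lra.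
have h4 : s * ((1 - I) + (q * ((1 - s) * (2 - s)) + (1 - s ^+ 2)) * (c * D)) <=
    s * (p * (N^-1 / q * e) * T) by lra.
rewrite ler_pM2l// in h4.
have h5 : 3 * q ^+ 2 * (c * D) <=
    (q * ((1 - s) * (2 - s)) + (1 - s ^+ 2)) * (c * D).
  rewrite ler_wpM2r//.
  have : q * (2 * q) <= q * ((1 - s) * (2 - s)) by rewrite ler_pM2l.
  have : q * q <= 1 * q by rewrite ler_wpM2r// ltW.
  by rewrite expr2; lra.
(* the defining property of [A] *)
have h6 : p * (N^-1 / q * e) * T =
    p ^+ 2 * e ^+ 2 / (2 * K * N * q ^+ 5) * S + 3 * q ^+ 2 * (c * D).
  rewrite /T /A /c; field.
  by rewrite !gt_eqF.
have h7 : 1 - I <= p ^+ 2 * e ^+ 2 / (2 * K * N * q ^+ 5) * S by lra.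
have pE : 1 - p = N^-1 by rewrite /p opprB addrCA subrr addr0.
have h8 : q * (p * (1 - p) / 2) * (e ^+ 2 * F) <=
    p ^+ 2 * e ^+ 2 / (2 * K * N * q ^+ 5) * S by lra.
pose M := 2 * N * q ^+ 5 / (p * e ^+ 2).
have M0 : 0 < M by rewrite /M !divr_gt0 ?mulr_gt0 ?exprn_gt0.
have := ler_wpM2l (ltW M0) h8.
have -> : M * (q * (p * (1 - p) / 2) * (e ^+ 2 * F)) = q ^+ 6 * F.
  by rewrite /M pE; field; rewrite !gt_eqF.
have -> : M * (p ^+ 2 * e ^+ 2 / (2 * K * N * q ^+ 5) * S) = (N - 1) / (K * N) * S.
  have pN : p = (N - 1) / N by rewrite /p; field; rewrite gt_eqF.
  have N10 : 0 < N - 1 by lra.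
  by rewrite /M pN; field; rewrite !gt_eqF.
by [].
Qed.

End arithmetic.

Section spectral_gap.
Context {R : realType} {X : pmetricType R}.
Local Open Scope ereal_scope.

Lemma supp_density (nu mu : probability (borel X) R) (sigma : X -> R) :
  measurable_fun [set: borel X] sigma ->
  (forall A, measurable A -> mu A = \int[nu]_(x in A) (sigma x)%:E) ->
  supp mu `<=` supp nu.
Proof.
move=> ms muE x mux A xA; rewrite lt0e measure_ge0 andbT.
apply/eqP => nuA; have := mux A xA.
have mA : measurable (A : set (borel X)) by apply: sub_sigma_algebra; case: xA.
rewrite muE// null_set_integral ?ltxx//.
by apply: measurable_funTS; exact/measurable_EFinP.
Qed.

Lemma compact_bounded_mdist : compact [set: X] ->
  exists2 B, (0 <= B)%R & forall x y : X, (mdist x y <= B)%R.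
Proof.
move=> cX.
have cd : continuous (fun x : X => mdist (point : X) x).
  apply: continuous_lipschitz; exists 1%R => x y.
  by rewrite mul1r (le_trans (mdist_lipschitz _ _ _ _))// mdistxx add0r.
have [B B0 hB] := compact_bounded_fun cX cd.
exists (B + B)%R; first exact: addr_ge0.
move=> x y; rewrite (le_trans (metric_triangle x point y))// lerD//.
  by rewrite metric_sym; exact: le_trans (ler_norm _) (hB x).
exact: le_trans (ler_norm _) (hB y).
Qed.

Lemma bounded_integrable (nu : probability (borel X) R) (f : X -> R) B :
  measurable_fun [set: borel X] f -> (forall x, (`|f x| <= B)%R) ->
  nu.-integrable setT (EFin \o f : borel X -> \bar R).
Proof.
move=> mf fB; apply: measurable_bounded_integrable => //.
  by rewrite -ge0_fin_numE// fin_num_measure.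
by exists B; split; [exact: num_real|move=> M BM x _ /=; rewrite (le_trans (fB x))// ltW].
Qed.

(** The whole argument at a fixed scale. The parameter [eta] bounds both [eps f],
    so that powers of [sigma] lie within factors [1 - 3 eta] of [1], and the time
    [s], which must also satisfy [s * diam X < 1 / (n + 1)] for the local slope at
    scale [n] to control the descent. *)
Lemma spectral_gap_local_slope (N K eta : R) (nu : probability (borel X) R)
    (f : X -> R) (n : nat) :
  (1 < N)%R -> (0 < K)%R -> (0 < eta < 3^-1)%R ->
  compact [set: X] -> ricci_bounded_below N K nu -> lipschitz_fun f ->
  \int[nu]_x (f x)%:E = 0 ->
  ((1 - 3 * eta) ^+ 6)%:E * \int[nu]_x (f x ^+ 2)%:E <=
  ((N - 1) / (K * N))%:E * \int[nu]_x (local_slope f n x ^+ 2).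
Proof.
move=> N1 K0 eta01 cX ricX lf meanf.
have [eta0 eta1] := andP eta01.
set q := (1 - 3 * eta)%R; have q0 : (0 < q)%R by rewrite /q; lra.
have q1 : (q <= 1)%R by rewrite /q; lra.
have Ni0 : (0 < N^-1)%R by rewrite invr_gt0; lra.
have Ni1 : (N^-1 < 1)%R by rewrite invf_lt1//; lra.
pose p := (1 - N^-1)%R.
have p01 : (0 < p < 1)%R by rewrite /p; lra.
have p0 : (0 < p)%R by lra.
have p1 : (p < 1)%R by lra.
have kap0 : (0 <= q * (p * (1 - p) / 2))%R.
  rewrite mulr_ge0 ?(ltW q0)// divr_ge0// mulr_ge0 ?(ltW p0)//.
  by rewrite subr_ge0 ltW.
have cf := continuous_lipschitz lf.
have mf : measurable_fun [set: borel X] f by exact: measurable_fun_continuous.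
have [B B0 fB] := compact_bounded_fun cX cf.
have [Dm Dm0 hDm] := compact_bounded_mdist cX.
have [eps eps0 feps] : exists2 eps, (0 < eps)%R &
    forall x, (`|eps * f x| <= eta)%R.
  exists (eta / (B + 1))%R => [|x]; first by rewrite divr_gt0// ltr_wpDl.
  rewrite normrM gtr0_norm ?divr_gt0 ?ltr_wpDl// -mulrA ger_pMr//.
  rewrite mulrC ler_pdivrMr ?mul1r ?ltr_wpDl//.
  by rewrite (le_trans (fB x))// lerDl.
have [s [s_gt0 s_eta s_dist]] : exists s, [/\ (0 < s)%R, (s <= eta)%R &
    forall x y : X, (s * mdist x y < n.+1%:R^-1)%R].
  have Dm1 : (0 < Dm + 1)%R by rewrite ltr_wpDl.
  exists (Num.min eta (n.+1%:R^-1 / (Dm + 1)))%R; split.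
  - by rewrite lt_min eta0/= divr_gt0.
  - by rewrite ge_min lexx.
  - move=> x y; apply: (@le_lt_trans _ _ (n.+1%:R^-1 / (Dm + 1) * Dm)%R).
      rewrite ler_pM ?mdist_ge0// ?ge_min ?lexx ?orbT//.
      by rewrite le_min (ltW eta0) divr_ge0// ltW.
    rewrite -mulrA gtr_pMr ?invr_gt0// mulrC ltr_pdivrMr// mul1r.
    by rewrite ltrDl.
have s_lt1 : (s < 1)%R by apply: le_lt_trans s_eta _; lra.
have hs1 : (2 * q <= (1 - s) * (2 - s))%R.
  have : (0 <= s * s)%R by rewrite mulr_ge0// ltW.
  by rewrite /q; lra.
have hs2 : (q <= 1 - s ^+ 2)%R.
  have : (s * s <= eta * s)%R by rewrite ler_wpM2r// ltW.
  have : (eta * s <= eta * 1)%R by rewrite ler_wpM2l// ltW.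
  by rewrite /q expr2; lra.
have a1 : (-2 <= p - 1 <= 0)%R by rewrite /p; lra.
pose sigma x := (1 + eps * f x)%R.
have ms : measurable_fun [set: borel X] sigma.
  by apply: measurable_funD => //; exact: measurable_funM.
have sI x : (1 - eta <= sigma x <= 1 + eta)%R.
  by have := feps x; rewrite ler_norml /sigma => /andP[? ?]; apply/andP; split; lra.
have s0 x : (0 < sigma x)%R by have := sI x; lra.
have sp2 x : (sigma x `^ p <= 2)%R.
  have := powR_le_quadratic eta01 p01 (sI x); rewrite -/q.
  have := mulr_ge0 kap0 (sqr_ge0 (sigma x - 1)%R).
  have [h|h] := leP 0%R (sigma x - 1)%R.
    by have := ler_wpM2r h (ltW p1); have := sI x; lra.
  by have := mulr_ge0_le0 (ltW p0) (ltW h); lra.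
have fi := bounded_integrable nu mf fB.
(* the zero mean of [f] makes [1 + a f] a probability density when it is
   nonnegative, and kills the first-order term of the expansion *)
have int_affine a : \int[nu]_x (1 + a * f x)%:E = 1.
  under eq_integral => x _ do rewrite EFinD EFinM.
  rewrite integralD//; last 2 first.
  - exact: finite_measure_integrable_cst.
  - exact: integrableZl.
  by rewrite integralZl// meanf mule0 adde0 integral_cst// mul1e [LHS]probability_setT.
have [mu muE] := ex_density_probability ms (fun x => ltW (s0 x)) (int_affine eps).
have supp_mu := supp_density ms muE.
have [Pi [[tp _] [k0 [k1 [dis0 dis1 conv]]]]] := ricX mu nu supp_mu (fun x h => h).
pose t : {i01 R} := Itv01 (ltW s_gt0) (ltW s_lt1).
have tE : t%:num = s by [].
have conv_t := conv _ (power_in_DC N1) t.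
have sp x : (q * sigma x <= sigma x `^ p)%R.
  have /andP[h _] := powR_near1 eta01 a1 (sI x).
  by rewrite -(mulr_powRB1 (ltW (s0 x)) p0) mulrC ler_wpM2l// ltW.
have st01 : (0 < t%:num < 1)%R by rewrite tE s_gt0.
have ineq1 := power_displacement_convexity cX N1 K0 (ltW q0) ms s0 muE sp
  dis0 dis1 st01 conv_t.
pose A := (p * eps / (2 * K * q ^+ 3))%R.
have A0 : (0 < A)%R.
  apply: divr_gt0; first exact: mulr_gt0.
  by apply: mulr_gt0; [exact: mulr_gt0|exact: exprn_gt0].
have t_dist (x y : X) : (t%:num * mdist x y < n.+1%:R^-1)%R by exact: s_dist.
have ineq2 := integral_powR_geodesic_le cX N1 eta01 (ltW eps0) A0 lf feps muE tp
  t_dist.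
rewrite -/p -/q in ineq1 ineq2.
pose F := \int[nu]_x (f x ^+ 2)%:E.
pose I := \int[nu]_x (sigma x `^ p)%:E.
have mf2 : measurable_fun [set: borel X] (fun x => (f x ^+ 2)%:E).
  by apply/measurable_EFinP; exact: measurable_funX.
have mI : measurable_fun [set: borel X] (fun x => (sigma x `^ p)%:E).
  by apply/measurable_EFinP; exact: (measurableT_comp (measurable_powR p) ms).
(* second-order expansion of the entropy at [nu] *)
have ineq3 : I + (q * (p * (1 - p) / 2) * eps ^+ 2)%:E * F <= 1.
  have kap_eps : 0 <= (q * (p * (1 - p) / 2) * eps ^+ 2)%:E.
    by rewrite lee_fin mulr_ge0// sqr_ge0.
  have f20 x : 0 <= (f x ^+ 2)%:E by rewrite lee_fin sqr_ge0.
  rewrite -(int_affine (p * eps)%R) /F -ge0_integralZl//.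
  rewrite -ge0_integralD//; last 3 first.
  - by move=> x _; rewrite lee_fin powR_ge0.
  - by move=> x _; exact: mule_ge0.
  - exact: measurable_funeM.
  apply: ge0_le_integralT => x.
    by apply: adde_ge0; [rewrite lee_fin powR_ge0|exact: mule_ge0].
  rewrite -EFinM -EFinD lee_fin.
  have := powR_le_quadratic eta01 p01 (sI x); rewrite -/q.
  rewrite /sigma [(1 + _ - 1)%R]addrAC subrr add0r exprMn !mulrA.
  exact.
have bnd (g : X -> R) M : measurable_fun [set: borel X] g ->
    (forall x, (`|g x| <= M)%R) -> \int[nu]_x (g x)%:E \is a fin_num.
  move=> mg gM; apply: integrable_fin_num => //.
  exact: bounded_integrable gM.
have Ffin : F \is a fin_num.
  apply: (bnd (fun x => f x ^+ 2)%R (B ^+ 2)%R); first exact: measurable_funX.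
  by move=> x; rewrite normrX ler_sqr ?nnegrE.
have Ifin : I \is a fin_num.
  apply: (bnd (fun x => sigma x `^ p)%R 2%R).
    exact: (measurableT_comp (measurable_powR p) ms).
  by move=> x; rewrite ger0_norm ?powR_ge0.
pose G x := fine (local_slope f n x).
have GE x : local_slope f n x = (G x)%:E by rewrite fineK// local_slope_fin_num.
have G0 x : (0 <= G x)%R by rewrite fine_ge0// local_slope_ge0.
have mG : measurable_fun [set: borel X] G.
  apply: measurableT_comp (measurable_local_slope n cf).
  exact: fine_measurable.
pose S := \int[nu]_x (local_slope f n x ^+ 2).
have Sfin : S \is a fin_num.
  rewrite /S; under eq_integral => x _ do rewrite GE -EFin_expe.
  have [L hL] := lf.
  apply: (bnd (fun x => G x ^+ 2)%R (`|L| ^+ 2)%R); first exact: measurable_funX.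
  move=> x; rewrite normrX ler_sqr ?nnegrE// ger0_norm// -lee_fin -GE.
  apply: local_slope_le => // u v; rewrite (le_trans (hL u v))//.
  by rewrite ler_wpM2r ?mdist_ge0// ler_norm.
pose plan := distribution Pi (@endpoints R X).
pose D := transport_cost plan.
have D0 : 0 <= D by apply: integral_ge0 => z _; rewrite lee_fin sqr_ge0.
have Dfin : D \is a fin_num.
  rewrite ge0_fin_numE//; apply: (@le_lt_trans _ _ (Dm ^+ 2)%:E); last exact: ltry.
  rewrite -[leRHS]mule1 -(probability_setT plan) -integral_cst//.
  apply: ge0_le_integralT => z; first by rewrite lee_fin sqr_ge0.
  by rewrite lee_fin ler_sqr ?nnegrE ?mdist_ge0.
pose J := \int[Pi]_c (sigma (eval_geodesic t c) `^ (p - 1))%:E.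
have J0 : 0 <= J by apply: integral_ge0 => c _; rewrite lee_fin powR_ge0.
have Jfin : J \is a fin_num.
  rewrite ge0_fin_numE//; apply: le_lt_trans ineq2 _.
  by rewrite -[X in X + _]/I -[\int[nu]_x (_ ^+ 2)]/S -[transport_cost _]/D
    -(fineK Ifin) -(fineK Sfin) -(fineK Dfin) -!EFinM -!EFinD ltry.
(* all the integrals are finite, and the rest takes place in [R] *)
rewrite -[\int[nu]_x (_ `^ _)%:E]/I -[\int[Pi]_c _]/J -[transport_cost _]/D in ineq1.
rewrite -[\int[nu]_x (_ `^ _)%:E]/I -[\int[Pi]_c _]/J -[transport_cost _]/D
   -[\int[nu]_x (_ ^+ 2)]/S in ineq2.
rewrite -/F -/S -(fineK Ffin) -(fineK Sfin) -!EFinM lee_fin.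
rewrite -(fineK Ffin) -(fineK Ifin) in ineq3.
rewrite -(fineK Sfin) -(fineK Ifin) -(fineK Jfin) -(fineK Dfin) in ineq2.
rewrite -(fineK Ifin) -(fineK Jfin) -(fineK Dfin) in ineq1.
rewrite -!EFinM -!EFinD lee_fin tE in ineq1.
rewrite -!EFinM -!EFinD lee_fin tE in ineq2.
rewrite -!EFinM -!EFinD lee_fin -[X in (_ + X <= _)%R]mulrA in ineq3.
exact: (spectral_gap_arith N1 K0 q0 q1 s_gt0 hs1 hs2 eps0 (fine_ge0 D0)
  ineq1 ineq2 ineq3).
Qed.

End spectral_gap.

Lemma cvg_integral_local_slope_sqr (R : realType) (X : pmetricType R)
    (nu : probability (borel X) R) (f : X -> R) : lipschitz_fun f ->
  (\int[nu]_x (local_slope f n x ^+ 2) @[n --> \oo] -->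
   \int[nu]_x (descending_slope f x ^+ 2))%E.
Proof.
move=> lf; have cf := continuous_lipschitz lf.
have [L hL] := lf.
have slope_le n x : (local_slope f n x <= `|L|%:E)%E.
  apply: local_slope_le => // u v; rewrite (le_trans (hL u v))//.
  by rewrite ler_wpM2r ?mdist_ge0// ler_norm.
apply: (@dominated_cvg _ _ _ nu setT measurableT _ _ (fun=> (`|L| ^+ 2)%:E)) => //.
- move=> n; under eq_fun do rewrite expe2.
  by apply: emeasurable_funM; exact: measurable_local_slope.
- move=> x _; rewrite expe2; under eq_fun do rewrite expe2.
  have def (l : \bar R) : (l *? l)%E.
    by case: l => [r| |]; rewrite /mule_def/= ?eqxx ?andbF.
  by apply: cvgeM => //; exact: cvg_local_slope.
- exact: finite_measure_integrable_cst.
- move=> n x _; rewrite gee0_abs ?sqre_ge0// EFin_expe.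
  by rewrite lee_sqr ?local_slope_ge0// lee_fin.
Qed.

Local Open Scope ereal_scope.

Theorem theorem5p34 (R : realType) (N K : R) (hN : (1 < N)%R) (hK : (0 < K)%R)
  (X : pmetricType R) (nu : probability (borel X) R)
  (compactX : compact [set: X]) (lengthX : length_space X)
  (ricciX : ricci_bounded_below N K nu)
  (f : X -> R) (lipf : lipschitz_fun f) (meanf : \int[nu]_x (f x)%:E = 0) :
  \int[nu]_x (f x ^+ 2)%:E <=
  ((N - 1) / (K * N))%:E * \int[nu]_x descending_slope f x ^+ 2.
Proof.
have cf := continuous_lipschitz lipf.
have mf : measurable_fun [set: borel X] f by exact: measurable_fun_continuous.
have [B B0 fB] := compact_bounded_fun compactX cf.
have Ffin : \int[nu]_x (f x ^+ 2)%:E \is a fin_num.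
  apply: integrable_fin_num => //.
  apply: (@bounded_integrable _ _ nu (fun x => f x ^+ 2)%R (B ^+ 2)%R).
    exact: measurable_funX.
  by move=> x; rewrite normrX ler_sqr ?nnegrE.
have F0 : 0 <= \int[nu]_x (f x ^+ 2)%:E.
  by apply: integral_ge0 => x _; rewrite lee_fin sqr_ge0.
set F := \int[nu]_x (f x ^+ 2)%:E in Ffin F0 *.
have le_n n : F <= ((N - 1) / (K * N))%:E * \int[nu]_x (local_slope f n x ^+ 2).
  have gap eta := @spectral_gap_local_slope R X N K eta nu f n hN hK.
  (* the error factor is at least [1 - 18 eta], and [eta] is chosen so that
     [18 eta F <= e] *)
  apply/lee_addgt0Pr => e e0.
  have Fe0 : (0 < 18 * fine F + 1)%R by have := fine_ge0 F0; lra.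
  pose eta := Num.min 9^-1%R (e / (18 * fine F + 1))%R.
  have eta0 : (0 < eta)%R by rewrite lt_min invr_gt0 ltr0n divr_gt0.
  have eta9 : (eta <= 9^-1)%R by rewrite ge_min lexx.
  have etae : (eta * (18 * fine F) <= e)%R.
    apply: (@le_trans _ _ (eta * (18 * fine F + 1))%R).
      by rewrite ler_wpM2l ?ltW// ltrDl.
    by rewrite -ler_pdivlMr// ge_min lexx orbT.
  have eta01 : (0 < eta < 3^-1)%R by rewrite eta0; lra.
  have := gap eta eta01 compactX ricciX lipf meanf; rewrite -/F => h.
  apply: (@le_trans _ _ (((1 - 3 * eta) ^+ 6)%:E * F + e%:E)); last exact: leeD2r.
  rewrite -(fineK Ffin) -EFinM -EFinD lee_fin.
  have bern : (1 - 18 * eta <= (1 - 3 * eta) ^+ 6)%R.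
    (* Bernoulli's inequality, by cubing and then squaring; [eta <= 1/9] keeps
       [1 - 9 eta] nonnegative *)
    have cube : (1 - 9 * eta <= (1 - 3 * eta) ^+ 3)%R.
      have : (0 <= eta ^+ 2 * (27 - 27 * eta))%R by rewrite mulr_ge0 ?sqr_ge0//; lra.
      by rewrite !exprS expr0; lra.
    rewrite (exprM _ 3 2) (@le_trans _ _ ((1 - 9 * eta) ^+ 2)%R)//.
      by have := sqr_ge0 (9 * eta)%R; rewrite !exprS expr0; lra.
    by rewrite ler_sqr ?nnegrE//; [lra|apply: le_trans cube; lra].
  have := ler_wpM2r (fine_ge0 F0) bern; lra.
have cv := cvgeZl (y := ((N - 1) / (K * N))%:E) isT
  (@cvg_integral_local_slope_sqr R X nu f lipf).
rewrite -(cvg_lim (@ereal_hausdorff R) cv); apply: lime_ge.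
  by apply/cvg_ex; eexists; exact: cv.
exact: nearW.
Qed.
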